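(* Let $a\ge 2$ be an integer, and let $p_t(x)/q_t(x)$ be the convergents of the series $g_3(x)$. Assume that there exist positive integers $n_0,t,p$ such that 1. $p\ge 5$ is a prime number and $p\,\|\,a^{3^{n_0}}-1$; 2. $|\Gamma(3,p^2)|=p\,|\Gamma(3,p)|$; 3. $t$ is even and $q_t(a^{3^{n_0}})\equiv 0\pmod{p^2}$; 4. $q_t'(1)\not\equiv 0\pmod p$. Then the real number $f_3(a)$ is not badly approximable.
   Context: Define the Laurent series $f_3(x)=\prod_{t=0}^{\infty}(1-x^{-3^t})\in\mathbb{Q}((x^{-1}))$, which converges for $|x|>1$, and $g_3(x)=x^{-2}f_3(x)$. Thus $f_3(a)=\prod_{t\ge0}(1-a^{-3^t})\in\mathbb{R}$. The series $g_3(x)$ has a continued fraction expansion $[a_0(x);a_1(x),a_2(x),\ldots]$ with $a_i(x)\in\mathbb{Q}[x]$, $a_i$ non-constant for $i\ge1$; its $t$-th convergent ($t\ge 0$) is $p_t(x)/q_t(x)=[a_0(x);a_1(x),\ldots,a_t(x)]$ in reduced form. The pair $(p_t,q_t)$ is defined up to a common non-zero constant, and is scaled so that $p_t,q_t\in\mathbb{Z}[x]$. $q_t'$ denotes the derivative of $q_t$. $p\,\|\,b$ means that $p$ divides $b$ but $p^2$ does not. $\Gamma(b,p^k)$ denotes the multiplicative subgroup of $(\mathbb{Z}/p^k\mathbb{Z})^*$ generated by $b$. A real number $\xi$ is badly approximable if there is a constant $c=c(\xi)>0$ such that $0<|\xi-r/s|$ and $|\xi-r/s|\ge c/s^2$ for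 all integers $r,s$ with $s\ne0$. *)

(* Defs.v *)
From HB Require Import structures.
From mathcomp Require Import all_boot all_order all_fingroup all_algebra.
From mathcomp Require Import boolp classical_sets reals topology normedtype.
From mathcomp Require Import sequences.
Set Implicit Arguments.
Unset Strict Implicit.
Unset Printing Implicit Defensive.
Import Order.TTheory GRing.Theory Num.Theory.
Import numFieldNormedType.Exports.
Local Open Scope ring_scope.

(* Formal power series over K.  The variable is written y; it stands for
   x^-1, so that the field K((x^-1)) of Laurent series is the fraction field
   of K[[y]]. *)
Record fps (K : fieldType) := Fps { fpsc :> nat -> K }.

HB.instance Definition _ (K : fieldType) := gen_eqMixin (fps K).
HB.instance Definition _ (K : fieldType) := gen_choiceMixin (fps K).

Lemma fpsP (K : fieldType) (f g : fps K) : (forall n, f n = g n) -> f = g.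
Proof. by case: f g => [f] [g] fg; congr Fps; apply: funext => n; exact: fg. Qed.

Definition fps_zero (K : fieldType) : fps K := Fps (fun=> 0).
Definition fps_opp (K : fieldType) (f : fps K) : fps K := Fps (fun n => - f n).
Definition fps_add (K : fieldType) (f g : fps K) : fps K :=
  Fps (fun n => f n + g n).
Definition fps_one (K : fieldType) : fps K := Fps (fun n => (n == 0)%:R).
Definition fps_mul (K : fieldType) (f g : fps K) : fps K :=
  Fps (fun n => \sum_(i < n.+1) f i * g (n - i)%N).

Lemma fps_addA (K : fieldType) : associative (@fps_add K).
Proof. by move=> f g h; apply: fpsP => n /=; rewrite addrA. Qed.
Lemma fps_addC (K : fieldType) : commutative (@fps_add K).
Proof. by move=> f g; apply: fpsP => n /=; rewrite addrC. Qed.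
Lemma fps_add0 (K : fieldType) : left_id (fps_zero K) (@fps_add K).
Proof. by move=> f; apply: fpsP => n /=; rewrite add0r. Qed.
Lemma fps_addN (K : fieldType) :
  left_inverse (fps_zero K) (@fps_opp K) (@fps_add K).
Proof. by move=> f; apply: fpsP => n /=; rewrite addNr. Qed.

HB.instance Definition _ (K : fieldType) := GRing.isZmodule.Build (fps K)
  (@fps_addA K) (@fps_addC K) (@fps_add0 K) (@fps_addN K).

Definition fps_trunc (K : fieldType) (n : nat) (f : fps K) : {poly K} :=
  \poly_(i < n) f i.

Lemma coef_fps_mul (K : fieldType) (f g : fps K) (n i : nat) : (i < n)%N ->
  fps_mul f g i = (fps_trunc n f * fps_trunc n g)`_i.
Proof.
move=> lt_in; rewrite coefM /=; apply: eq_bigr => -[j /= lt_ji] _.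
rewrite !coef_poly (leq_ltn_trans _ lt_in) ?(leq_ltn_trans _ lt_in) //.
exact: leq_subr.
Qed.

Lemma fps_mulC (K : fieldType) : commutative (@fps_mul K).
Proof.
by move=> f g; apply: fpsP => n; rewrite !(coef_fps_mul _ _ (ltnSn n)) mulrC.
Qed.

Lemma fps_mulA (K : fieldType) : associative (@fps_mul K).
Proof.
move=> f g h; apply: fpsP => n; set T := @fps_trunc K n.+1.
transitivity ((T f * (T g * T h))`_n).
  rewrite coefM /=; apply: eq_bigr => -[j /= lt_jn] _.
  rewrite coef_poly lt_jn -coef_fps_mul //.
  by rewrite ltnS leq_subr.
rewrite mulrA coefM /=; apply: eq_bigr => -[j /= lt_jn] _.
rewrite -coef_fps_mul //; congr (_ * _).
by rewrite coef_poly ltnS leq_subr.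
Qed.

Lemma fps_mul1 (K : fieldType) : left_id (fps_one K) (@fps_mul K).
Proof.
move=> f; apply: fpsP => n /=; rewrite big_ord_recl /= mul1r subn0.
by rewrite big1 ?addr0 // => i _; rewrite mul0r.
Qed.

Lemma fps_mulDl (K : fieldType) : left_distributive (@fps_mul K) (@fps_add K).
Proof.
move=> f g h; apply: fpsP => n /=; rewrite -big_split /=.
by apply: eq_bigr => i _; rewrite mulrDl.
Qed.

Lemma fps_one_neq0 (K : fieldType) : fps_one K != 0.
Proof.
by apply/eqP => /(congr1 (fun f : fps K => f 0%N)) /= /eqP; rewrite oner_eq0.
Qed.

HB.instance Definition _ (K : fieldType) :=
  GRing.Zmodule_isComNzRing.Build (fps K) (@fps_mulA K) (@fps_mulC K)
    (@fps_mul1 K) (@fps_mulDl K) (@fps_one_neq0 K).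

Definition fps_unit (K : fieldType) : {pred fps K} :=
  fun f => `[< exists g : fps K, g * f = 1 >].
Definition fps_inv (K : fieldType) (f : fps K) : fps K :=
  if pselect (exists g : fps K, g * f = 1) is left e
  then projT1 (cid e) else f.

Lemma fps_mulVf (K : fieldType) :
  {in @fps_unit K, left_inverse 1 (@fps_inv K) *%R}.
Proof.
move=> f; rewrite unfold_in => /asboolP fU; rewrite /fps_inv.
by case: pselect => // e; exact: projT2 (cid e).
Qed.

Lemma fps_unitPl (K : fieldType) (f g : fps K) : g * f = 1 -> fps_unit f.
Proof. by move=> gf; apply/asboolP; exists g. Qed.

Lemma fps_inv_out (K : fieldType) :
  {in [predC @fps_unit K], @fps_inv K =1 id}.
Proof.
move=> f; rewrite inE /= => /asboolP nU.
by rewrite /fps_inv; case: pselect.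
Qed.

HB.instance Definition _ (K : fieldType) :=
  GRing.ComNzRing_hasMulInverse.Build (fps K) (@fps_mulVf K) (@fps_unitPl K)
    (@fps_inv_out K).

Lemma fps_neq0_lead (K : fieldType) (f : fps K) : f != 0 ->
  exists m : nat, f m != 0 /\ forall i, (i < m)%N -> f i = 0.
Proof.
move=> f_neq0; have exf : exists n, f n != 0.
  apply: contrapT => nex; move/eqP: f_neq0; apply; apply: fpsP => n.
  by apply: contrapT => /eqP fn; apply: nex; exists n.
case: (ex_minnP exf) => m fm mmin; exists m; split=> // i lt_im.
by apply/eqP; apply: contraLR lt_im => /mmin; rewrite -leqNgt.
Qed.

Lemma fps_integral (K : fieldType) (f g : fps K) :
  f * g = 0 -> (f == 0) || (g == 0).
Proof.
move=> fg0; apply/norP => -[/fps_neq0_lead[m [fm fm0]]].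
move=> /fps_neq0_lead[k [gk gk0]].
have := congr1 (fun h : fps K => h (m + k)%N) fg0.
have lt_m : (m < (m + k).+1)%N by rewrite ltnS leq_addr.
rewrite /= (bigD1 (Ordinal lt_m)) //= addKn big1 => [|i].
  by rewrite addr0 => /eqP; rewrite mulf_eq0 (negPf fm) (negPf gk).
rewrite -val_eqE /= neq_ltn => /orP[lt_im|lt_mi]; first by rewrite fm0 ?mul0r.
have le_i : (i <= m + k)%N by rewrite -ltnS.
by rewrite gk0 ?mulr0 // -(ltn_add2l i) subnKC // ltn_add2r.
Qed.

HB.instance Definition _ (K : fieldType) :=
  GRing.ComUnitRing_isIntegral.Build (fps K) (@fps_integral K).

(* K((x^-1)) *)
Definition laurent (K : fieldType) : fieldType := {fraction (fps K)}.

Definition fpsC (K : fieldType) (c : K) : fps K :=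
  Fps (fun n => if n == 0%N then c else 0).
Definition fpsY (K : fieldType) : fps K := Fps (fun n => (n == 1%N)%:R).

Definition fps_of_poly (K : fieldType) (P : {poly K}) : fps K :=
  Fps (fun n => P`_n).

Lemma fps_of_poly_is_zmod_morphism (K : fieldType) :
  zmod_morphism (@fps_of_poly K).
Proof. by move=> P Q; apply: fpsP => n /=; rewrite coefB. Qed.
Lemma fps_of_poly_is_monoid_morphism (K : fieldType) :
  monoid_morphism (@fps_of_poly K).
Proof.
split=> [|P Q]; apply: fpsP => n /=; first by rewrite coef1.
by rewrite coefM.
Qed.
HB.instance Definition _ (K : fieldType) :=
  GRing.isZmodMorphism.Build {poly K} (fps K) (@fps_of_poly K)
    (@fps_of_poly_is_zmod_morphism K).
HB.instance Definition _ (K : fieldType) :=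
  GRing.isMonoidMorphism.Build {poly K} (fps K) (@fps_of_poly K)
    (@fps_of_poly_is_monoid_morphism K).

Lemma fps_of_polyX (K : fieldType) : fps_of_poly 'X = fpsY K.
Proof. by apply: fpsP => n /=; rewrite coefX. Qed.

Lemma fps_coefYnM (K : fieldType) (f : fps K) (m n : nat) :
  (fpsY K ^+ m * f) n = if (n < m)%N then 0 else f (n - m)%N.
Proof.
rewrite -fps_of_polyX -rmorphXn /=; case: ltnP => [lt_nm|le_mn].
  rewrite big1 // => -[i /= lt_in] _.
  by rewrite coefXn ltn_eqF ?mul0r // (leq_trans lt_in).
have lt_m : (m < n.+1)%N by [].
rewrite (bigD1 (Ordinal lt_m)) //= coefXn eqxx mul1r big1 ?addr0 // => i.
by rewrite -val_eqE /= coefXn => /negPf ->; rewrite mul0r.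
Qed.

Definition lau_of_fps (K : fieldType) (f : fps K) : laurent K := tofrac f.

Definition lauX (K : fieldType) : laurent K := (lau_of_fps (fpsY K))^-1.

Definition lau_of_poly (K : fieldType) (P : {poly K}) : laurent K :=
  (map_poly (@lau_of_fps K \o @fpsC K) P).[lauX K].

(* Convergence for the degree valuation: l - u t is eventually in
   x^-N K[[x^-1]], for every N. *)
Definition lau_cvg (K : fieldType) (u : nat -> laurent K) (l : laurent K) :=
  forall N : nat, exists T : nat, forall t : nat, (T <= t)%N ->
    exists h : fps K, l - u t = lau_of_fps h * lauX K ^- N.

(* [a_0; a_1, ..., a_t]; as 0^-1 = 0, the last step is a_t + 0^-1 = a_t. *)
Definition contfrac (F : fieldType) (s : seq F) : F :=
  foldr (fun a r => a + r^-1) 0 s.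

Definition convergent (K : fieldType) (A : nat -> {poly K}) (t : nat) :
  laurent K := contfrac [seq lau_of_poly (A i) | i <- iota 0 t.+1].

Definition cf_expansion (K : fieldType) (g : laurent K) (A : nat -> {poly K}) :=
  (forall i : nat, (0 < i)%N -> (1 < size (A i))%N) /\
  lau_cvg (convergent A) g.

Definition polyQ (P : {poly int}) : {poly rat} := map_poly (intr : int -> rat) P.

(* P / Q is the t-th convergent in reduced form; the common constant factor
   of the pair is only constrained by integrality. *)
Definition reduced_convergent (A : nat -> {poly rat}) (t : nat)
    (P Q : {poly int}) : Prop :=
  [/\ Q != 0, coprimep (polyQ P) (polyQ Q) &
      lau_of_poly (polyQ P) / lau_of_poly (polyQ Q) = convergent A t].

(* The coefficient of y^n in the infinite product: the factors 1 - y^(3^t)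
   with t > n do not contribute to it. *)
Definition f3_fps : fps rat :=
  Fps (fun n => (\prod_(0 <= t < n.+1) (1 - 'X^(3 ^ t)) : {poly rat})`_n).

Lemma f3_fps_stable (n m : nat) : (n < m)%N ->
  f3_fps n = (\prod_(0 <= t < m) (1 - 'X^(3 ^ t)) : {poly rat})`_n.
Proof.
move=> lt_nm; rewrite -(subnKC lt_nm).
elim: (m - n.+1)%N => [|d IHd]; first by rewrite addn0.
rewrite addnS big_nat_recr //= mulrBr mulr1 coefB coefMXn -IHd.
have -> : (n < 3 ^ (n.+1 + d))%N.
  rewrite (leq_ltn_trans (leq_addr d n)) // (ltn_trans (ltnSn _)) //.
  by rewrite -addSn ltn_expl.
by rewrite subr0.
Qed.

Definition f3 : laurent rat := lau_of_fps f3_fps.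
Definition g3 : laurent rat := lauX rat ^- 2 * f3.

Lemma f3_cvg :
  lau_cvg (fun n => \prod_(0 <= t < n) (1 - lauX rat ^- (3 ^ t))) f3.
Proof.
move=> N; exists N => t le_Nt.
have powY m : lauX rat ^- m = lau_of_fps (fpsY rat ^+ m).
  by rewrite /lauX /lau_of_fps -exprVn invrK rmorphXn.
have -> : \prod_(0 <= i < t) (1 - lauX rat ^- (3 ^ i)) =
    lau_of_fps (fps_of_poly (\prod_(0 <= i < t) (1 - 'X^(3 ^ i)))).
  rewrite /lau_of_fps !rmorph_prod /=; apply: eq_bigr => i _.
  by rewrite !rmorphB !rmorph1 rmorphXn /= fps_of_polyX powY.
pose f := f3_fps - fps_of_poly (\prod_(0 <= i < t) (1 - 'X^(3 ^ i))).
exists (Fps (fun n => f (n + N)%N)).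
rewrite powY /f3 /lau_of_fps -rmorphB -rmorphM; congr tofrac; apply: fpsP => n.
rewrite mulrC fps_coefYnM; case: ltnP => [lt_nN|le_Nn] /=; last by rewrite subnK.
by apply/eqP; rewrite subr_eq0 -(f3_fps_stable (leq_trans lt_nN le_Nt)).
Qed.

Definition f3_real (R : realType) (a : nat) : R :=
  limn (fun n : nat => \prod_(0 <= t < n) (1 - (a%:R : R) ^- (3 ^ t))).

Lemma f3_real_cvg (R : realType) (a : nat) : (2 <= a)%N ->
  cvgn (fun n : nat => \prod_(0 <= t < n) (1 - (a%:R : R) ^- (3 ^ t))).
Proof.
move=> a_ge2; have a1 : 1 <= a%:R :> R by rewrite ler1n ltnW.
have fac t : 0 <= 1 - (a%:R : R) ^- (3 ^ t) <= 1.
  have an1 : 1 <= (a%:R : R) ^+ (3 ^ t) by rewrite exprn_ege1.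
  have an0 : 0 < (a%:R : R) ^+ (3 ^ t) by rewrite (lt_le_trans ltr01).
  by rewrite subr_ge0 invf_le1 // an1 gerBl invr_ge0 ltW.
have prod_ge0 n : 0 <= \prod_(0 <= t < n) (1 - (a%:R : R) ^- (3 ^ t)).
  by apply: prodr_ge0 => i _; case/andP: (fac i).
apply: nonincreasing_is_cvgn; last first.
  by exists 0 => _ [n _ <-]; exact: prod_ge0.
apply/nonincreasing_seqP => n; rewrite big_nat_recr //=.
by rewrite ler_piMr //; case/andP: (fac n).
Qed.

Definition badly_approximable (R : realType) (xi : R) : Prop :=
  exists c : R, 0 < c /\ forall r s : int, s != 0 ->
    0 < `|xi - r%:~R / s%:~R| /\ c / s%:~R ^+ 2 <= `|xi - r%:~R / s%:~R|.

(* The subgroup of (Z/mZ)^* generated by b.  The generating set is {b} when b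
   is invertible modulo m, and empty otherwise.  Requires m > 1, as 'Z_0 and
   'Z_1 are both Z/2Z. *)
Definition Gamma (b m : nat) : {set {unit 'Z_m}} :=
  <<[set u : {unit 'Z_m} | FinRing.uval u == b%:R :> 'Z_m]>>%g.

(* Main.v *)
Require Import Defs.
From HB Require Import structures.
From mathcomp Require Import all_boot all_order all_fingroup all_algebra.
From mathcomp Require Import boolp classical_sets reals topology normedtype.
From mathcomp Require Import cyclic sequences.
From mathcomp Require Import zify ring lra.
Set Implicit Arguments.
Unset Strict Implicit.
Unset Printing Implicit Defensive.
Import Order.TTheory GRing.Theory Num.Theory.
Import numFieldNormedType.Exports.
Local Open Scope ring_scope.

(** Truncating the infinite product to its first m factors replaces f_3 by
    [f3_num m] / x^S, where [f3_num m] is the product of the x^(3^t) - 1 for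
    t < m and S = [sum_pow3 m] = (3^m - 1)/2, with an error of order 3^m.
    Once m is large, q g_3 - p is of order at least e if and only if the
    polynomial remainder q * [f3_num m] - x^(S + 2) * p has degree at most
    S + 2 - e.  All the facts on the continued fraction are stated and proved
    on these remainders; [cf_approx] is the passage from Laurent series.

    The proof that f_3(a) is not badly approximable combines three facts.

    Degrees.  The degrees of the denominators q_t are 0, 2, 3, 5, 6, 8, ...,
    that is, all the natural numbers outside 1 + 3N.
    - No degree is 3k + 1.  If P/Q is a Pade approximant of x^-1 f_3 with
      deg Q <= k, the functional equation f_3(x) = (1 - x^-1) f_3(x^3) makes
      Q(x^3) a denominator of degree at most 3k that approximates g_3 to order
      3k + 2 ([mahler_approx]); a convergent of degree 3k + 1 would have to be
      proportional to it ([coprime_approx_size]).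
    - No n outside 1 + 3N is skipped.  If n were strictly between the degrees
      of two consecutive denominators, the smaller one, Q, would satisfy
      deg Q < n and approximate g_3 to order n + 1, and this survives reduction
      modulo 3 after division by the content.  In characteristic 3 the square
      of g_3 is 1/(x^3 (x - 1)), so such an approximation is a solution of the
      Pell equation Q^2 - x^3 (x - 1) P^2 = c of degree n - 1.  Differentiating
      the equation gives Q' = 0, so 3 divides n - 1 ([excess_approx_pchar3]).
    So for t even deg q_(t+1) exceeds deg q_t by 2 ([size_den_even]): with
    d = deg q_t, q_t g_3 - p_t is of order d + 2 rather than d + 1.

    Reals.  At x = a^(3^m) this gives |q_t(x) f_3(x) - x^2 p_t(x)| = O(x^-d)
    ([real_approx]), and f_3(a) is f_3(x) times [f3_num m](a) / a^S.  As
    x^2 / a^S is an integer, f_3(a) is approximated by a fraction r/s with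
    s = q_t(x) = O(x^d) and |s f_3(a) - r| = O(x^-d), where r is a multiple of
    [f3_num m](a).  These fractions alone are only as good as for a badly
    approximable number, but a common factor p^K of s and r improves
    |s| |s f_3(a) - r| by p^(2K) ([not_badly_approximable]).

    Divisibility.  With b = a^(3^n0), p divides b - 1, hence all but n0 factors
    of [f3_num m](a).  On the other side q_t has a simple root modulo p at 1,
    which lifts to a p-adic root congruent to b modulo p^2.  The hypothesis on
    Gamma makes the closure of the powers of 3 in the p-adic units contain
    1 + p Z_p, so the powers b^(3^n) come arbitrarily close to every element of
    b + p^2 Z_p, in particular to that root ([hensel_orbit]). *)

(** * The truncated products *)

Definition sum_pow3 (m : nat) : nat := \sum_(0 <= t < m) 3 ^ t.

Lemma sum_pow3S m : sum_pow3 m.+1 = (sum_pow3 m + 3 ^ m)%N.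
Proof. by rewrite /sum_pow3 big_nat_recr. Qed.

Lemma sum_pow3E m : (2 * sum_pow3 m + 1)%N = (3 ^ m)%N.
Proof.
elim: m => [|m IH]; first by rewrite /sum_pow3 big_geq.
by rewrite sum_pow3S expnS -IH; lia.
Qed.

Lemma leq_sum_pow3 m : (m <= sum_pow3 m)%N.
Proof.
elim: m => // m IH; rewrite sum_pow3S.
have := expn_gt0 3 m; lia.
Qed.

Definition f3_num (R : nzRingType) (m : nat) : {poly R} :=
  \prod_(0 <= t < m) ('X^(3 ^ t) - 1).

Lemma f3_numS (R : nzRingType) m :
  f3_num R m.+1 = f3_num R m * ('X^(3 ^ m) - 1).
Proof. by rewrite /f3_num big_nat_recr. Qed.

(** The functional equation f_3(x) = (1 - x^-1) f_3(x^3), on numerators. *)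
Lemma f3_num_comp (R : comNzRingType) m :
  f3_num R m.+1 = ('X - 1) * (f3_num R m \Po 'X^3).
Proof.
elim: m => [|m IH].
  by rewrite /f3_num big_nat1 big_geq // expn0 expr1 comp_polyC mulr1.
rewrite [LHS]f3_numS [in RHS]f3_numS comp_polyM mulrA -IH; congr (_ * _).
by rewrite comp_polyB comp_Xn_poly comp_polyC -exprM expnS.
Qed.

Lemma f3_num_monic (R : idomainType) m : f3_num R m \is monic.
Proof.
rewrite /f3_num monic_prod // => i _.
by rewrite -[1]/(1%:P) monicXnsubC // expn_gt0.
Qed.

Lemma size_f3_num (R : idomainType) m : size (f3_num R m) = (sum_pow3 m).+1.
Proof.
elim: m => [|m IH].
  by rewrite /f3_num big_geq // size_poly1 /sum_pow3 big_geq.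
rewrite f3_numS size_Mmonic ?monic_neq0 ?f3_num_monic //.
  by rewrite -[1]/(1%:P) size_XnsubC ?expn_gt0 // IH sum_pow3S; lia.
by rewrite -[1]/(1%:P) monicXnsubC // expn_gt0.
Qed.

Lemma map_f3_num (R S : nzRingType) (f : {rmorphism R -> S}) m :
  map_poly f (f3_num R m) = f3_num S m.
Proof.
rewrite /f3_num rmorph_prod; apply: eq_bigr => i _.
by rewrite rmorphB rmorph1 /= map_polyXn.
Qed.

(** * Excess of approximation in characteristic 3 *)

Lemma pchar3_XsubC_exp (F : fieldType) t : 3%N \in [pchar F] ->
  ('X - 1) ^+ (3 ^ t) = 'X^(3 ^ t) - 1 :> {poly F}.
Proof.
move=> F3; have P3 : 3%N \in [pchar {poly F}] by rewrite pchar_poly.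
elim: t => [|t IH]; first by rewrite !expr1.
rewrite expnSr !exprM IH -!(pFrobenius_autE P3) rmorphB /=.
by rewrite pFrobenius_aut1.
Qed.

Lemma f3_num_pchar3 (F : fieldType) m : 3%N \in [pchar F] ->
  f3_num F m = ('X - 1) ^+ sum_pow3 m.
Proof.
move=> F3; elim: m => [|m IH].
  by rewrite /f3_num /sum_pow3 !big_geq // expr0.
by rewrite f3_numS IH -pchar3_XsubC_exp // sum_pow3S exprD.
Qed.

Lemma size_mulXn_leq (R : idomainType) (n k : nat) (W : {poly R}) :
  (size ('X^n * W)%R <= n + k)%N -> (size W <= k)%N.
Proof.
have [-> _|W0] := eqVneq W 0; first by rewrite size_poly0.
by rewrite mulrC size_mulXn // leq_add2l.
Qed.

Lemma size_sqr (R : idomainType) (p : {poly R}) :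
  size (p ^+ 2) = (size p + size p).-1.
Proof.
have [->|p0] := eqVneq p 0; first by rewrite expr0n size_poly0.
by rewrite expr2 size_mul.
Qed.

(** The two sides have multiplicities of different parities at the root 1. *)
Lemma sqr_neq_X3subC_sqr (F : fieldType) (Q P : {poly F}) : Q != 0 ->
  Q ^+ 2 != 'X^3 * ('X - 1) * P ^+ 2.
Proof.
move=> Q0; apply/eqP => E.
have P0 : P != 0.
  by apply: contraNneq Q0 => P0; rewrite -sqrf_eq0 E P0 expr0n mulr0.
have := congr1 (mup 1) E.
rewrite !expr2 mupM // mupM ?mulf_neq0 ?expf_neq0 ?polyX_eq0 ?polyXsubC_eq0 //.
rewrite mupM // mupMr; last first.
  by rewrite /root !hornerE expr1n oner_neq0.
have := @mup_XsubCX F 1 1 1; rewrite expr1 eqxx => ->; lia.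
Qed.

(** In characteristic 3 the derivative of x^3 vanishes, so differentiating
    the equation shows that x^3 P divides Q Q'.  It is coprime to Q by the
    equation itself, and too large to divide a nonzero Q'.  So Q is a
    polynomial in x^3. *)
Lemma pell_size_pchar3 (F : fieldType) (n : nat) (Q P : {poly F}) (c : F) :
  3%N \in [pchar F] -> c != 0 -> size Q = n.+1 ->
  Q ^+ 2 - 'X^3 * ('X - 1) * P ^+ 2 = c%:P -> (3 %| n)%N.
Proof.
move=> F3 c0 sQ E.
have Q0 : Q != 0 by rewrite -size_poly_eq0 sQ.
have [->|n0] := eqVneq n 0%N; first by rewrite dvdn0.
have [P0|P0] := eqVneq P 0.
  have := congr1 (size \o polyseq) E.
  rewrite /= P0 expr0n mulr0 subr0 size_sqr sQ size_polyC c0 /= => H.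
  by move: H n0; clear; case: n => // n; rewrite addnS.
have X1 : 'X - 1 != 0 :> {poly F} by rewrite polyXsubC_eq0.
have X1m : 'X - 1 \is @monic F by rewrite monicXsubC.
have sX1 : size ('X - 1 : {poly F}) = 2%N by rewrite size_XsubC.
have sP : size P = n.-1.
  have : size (Q ^+ 2 - c%:P) = size ('X^3 * ('X - 1) * P ^+ 2).
    by rewrite -E opprB addrC subrK.
  rewrite size_polyDl; last first.
    by rewrite size_polyN size_polyC c0 size_sqr sQ; lia.
  rewrite -mulrA mulrC size_mulXn ?mulf_neq0 ?expf_neq0 //.
  rewrite size_monicM ?expf_neq0 // sX1 !size_sqr sQ.
  by move: P0 n0; rewrite -size_poly_gt0; case: (size P) => // s; clear; lia.
have cop : coprimep ('X^3 * P) Q.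
  apply/Bezout_eq1_coprimepP.
  exists (- c^-1 *: (('X - 1) * P), c^-1 *: Q) => /=.
  rewrite -!scalerAl scaleNr addrC -scalerBr.
  transitivity (c^-1 *: c%:P); last by rewrite -mul_polyC -polyCM mulVf.
  by rewrite -E; congr (_ *: _); ring.
have dQ : ('X^3 * P) %| Q^`().
  have three : 3%:R = 0 :> {poly F} by rewrite -polyC_natr (pcharf0 F3).
  have D : Q^`() * Q + Q * Q^`() =
      'X^3 * (P * P + ('X - 1) * (P^`() * P + P * P^`())).
    have dX3 : ('X^3)^`() = 0 :> {poly F}.
      by rewrite derivXn -mulr_natl three mul0r.
    apply/eqP; rewrite -subr_eq0 -[X in _ == X](derivC c) -E.
    move: ('X^3) dX3 => X3 dX3.
    rewrite !expr2 derivB !derivM dX3 derivB derivX -[1]/(1%:P) derivC.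
    apply/eqP; ring.
  rewrite -(Gauss_dvdpr _ cop).
  (* In characteristic 3, Q Q' is the opposite of its double. *)
  have -> : Q * Q^`() = - ('X^3 * P * (P + ('X - 1) * P^`() * 2%:R)).
    have -> : 'X^3 * P * (P + ('X - 1) * P^`() * 2%:R) =
      'X^3 * (P * P + ('X - 1) * (P^`() * P + P * P^`())) by ring.
    rewrite -D -[LHS]addr0 -(mul0r (- (Q * Q^`()))) -three; ring.
  by rewrite dvdpNr dvdp_mulr.
have Q'0 : Q^`() = 0.
  apply/eqP; apply: contraTT dQ => Q'0; apply/negP => /(dvdp_leq Q'0).
  rewrite mulrC size_mulXn // sP; have := lt_size_deriv Q0; rewrite sQ.
  by move: (size _) n0 => s; clear; lia.
have : Q^`()`_n.-1 = 0 by rewrite Q'0 coef0.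
rewrite coef_deriv prednK ?lt0n // -mulr_natr => /eqP.
rewrite mulf_eq0 => /orP[]; last by rewrite (dvdn_pcharf F3).
have -> : Q`_n = lead_coef Q by rewrite lead_coefE sQ.
by rewrite lead_coef_eq0 (negPf Q0).
Qed.

(** The hypotheses say that deg Q < n and that Q g_3 - P is of order n + 1.
    Since g_3^2 = 1/(x^3 (x - 1)) here, multiplying Q g_3 - P by Q g_3 + P
    shows that Q^2 - x^3 (x - 1) P^2 has degree at most 0, and that it vanishes
    unless deg Q = n - 1. *)
Lemma excess_approx_pchar3 (F : fieldType) (m n : nat) (Q P : {poly F}) :
  3%N \in [pchar F] -> (n <= sum_pow3 m)%N -> Q != 0 -> (size Q <= n)%N ->
  (size (Q * f3_num F m - 'X^(sum_pow3 m + 2) * P)%R <= sum_pow3 m + 2 - n)%N ->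
  (n %% 3 = 1)%N.
Proof.
move=> F3 nS Q0 sQ; set T := _ - _ => sT.
have n0 : (0 < n)%N by apply: leq_trans sQ; rewrite size_poly_gt0.
suff: (3 %| n.-1)%N by move: n0; clear; lia.
set S := sum_pow3 m in nS T sT *.
pose W := Q ^+ 2 - 'X^3 * ('X - 1) * P ^+ 2.
have Xq : ('X - 1) ^+ (2 * S + 1) = 'X^(2 * S + 1) - 1 :> {poly F}.
  by rewrite sum_pow3E pchar3_XsubC_exp.
pose N : {poly F} := ('X - 1) ^+ S.
have ET : T = Q * N - 'X^(S + 2) * P by rewrite /T f3_num_pchar3.
(* N^2 ('X - 1) = ('X - 1)^(3^m) = 'X^(3^m) - 1, as 2 S + 1 = 3^m. *)
have EW : 'X^(2 * S + 1) * W = Q ^+ 2 + ('X - 1) * (T * (Q * N *+ 2 - T)).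
  have -> : Q ^+ 2 = 'X^(2 * S + 1) * Q ^+ 2 - ('X - 1) ^+ (2 * S + 1) * Q ^+ 2.
    by rewrite Xq; ring.
  rewrite ET /W /N mulnC addn1 !exprS !exprM exprD; ring.
have sN : size N = S.+1.
  by rewrite /N -(f3_num_pchar3 m F3) size_f3_num.
have sQN : size (Q * N) = (size Q + S)%N.
  rewrite size_Mmonic // ?sN ?addnS //.
  by rewrite /N -(f3_num_pchar3 m F3) f3_num_monic.
have sX1 : size ('X - 1 : {poly F}) = 2%N by rewrite size_XsubC.
have sD : (size (Q * N *+ 2 - T)%R <= maxn (size Q + S) (S + 2 - n))%N.
  rewrite (leq_trans (size_polyD _ _)) // size_polyN geq_max !leq_max sT orbT.
  by rewrite andbT mulr2n (leq_trans (size_polyD _ _)) // maxnn sQN leqnn.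
have sE : (size ('X^(2 * S + 1) * W)%R <= 2 * S + 1 + (size Q == n))%N.
  rewrite EW (leq_trans (size_polyD _ _)) // geq_max size_sqr.
  have := size_polyMleq ('X - 1) (T * (Q * N *+ 2 - T)).
  have := size_polyMleq T (Q * N *+ 2 - T).
  have := Q0; rewrite sX1 -size_poly_gt0.
  have := sT; have := sD; move: sQ nS n0.
  move: (size (_ * (T * _))) (size (T * _)) (size T) (size (_ - T)) (size Q).
  clear=> u v w x y; case: (eqVneq y n) => [->|/eqP]; lia.
have := size_mulXn_leq sE.
have [sQn|] := eqVneq (size Q) n; last first.
  move=> _; rewrite leqn0 size_poly_eq0 subr_eq0 => W0.
  by move: (sqr_neq_X3subC_sqr P Q0); rewrite W0.
move=> /size1_polyC WE.
have [c0|c0] := eqVneq W`_0 0.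
  move/eqP: WE; rewrite c0 subr_eq0 => W0.
  by move: (sqr_neq_X3subC_sqr P Q0); rewrite W0.
by apply: (pell_size_pchar3 F3 c0 _ WE); rewrite sQn prednK.
Qed.

(** Dividing Q by its content keeps the vanishing of the middle coefficients
    of the remainder, hence the quality of the approximation, and makes the
    reduction of Q modulo 3 nonzero. *)
Lemma excess_approx_int (m n : nat) (Q P : {poly int}) :
  (n <= sum_pow3 m)%N -> Q != 0 -> (size Q <= n)%N ->
  (size (Q * f3_num int m - 'X^(sum_pow3 m + 2) * P)%R
     <= sum_pow3 m + 2 - n)%N ->
  (n %% 3 = 1)%N.
Proof.
move=> nS Q0 sQ sT; set S := sum_pow3 m in nS sT *.
set N := f3_num int m in sT.
pose Q1 := zprimitive Q; pose P1 := drop_poly (S + 2) (Q1 * N).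
have Q10 : Q1 != 0 by rewrite zprimitive_eq0.
have sT1 : (size (Q1 * N - 'X^(S + 2) * P1)%R <= S + 2 - n)%N.
  apply/leq_sizeP => i le_i.
  rewrite coefB coefXnM coef_drop_poly; case: ltnP => [lt_i|ge_i]; last first.
    by rewrite subnK // subrr.
  rewrite subr0; have /leq_sizeP/(_ i le_i) := sT.
  rewrite coefB coefXnM lt_i subr0 {1}[Q]zpolyEprim -scalerAl coefZ => /eqP.
  by rewrite mulf_eq0 zcontents_eq0 (negPf Q0) => /eqP.
pose f : {rmorphism int -> 'F_3} := intr.
have F3 : 3%N \in [pchar 'F_3] by rewrite pchar_Fp.
apply: (@excess_approx_pchar3 'F_3 m n (map_poly f Q1) (map_poly f P1)) => //.
- apply/eqP => E; have dvd3 i : (3 %| Q1`_i)%Z.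
    have := congr1 (fun q : {poly 'F_3} => q`_i) E.
    by rewrite coef_map coef0 /= => /eqP; rewrite -(dvdz_pcharf F3).
  have : (3 %| zcontents Q1)%Z by rewrite dvdz_contents; apply/polyOverP.
  by rewrite zcontents_primitive Q0.
- by rewrite (leq_trans (size_poly _ _)) // size_zprimitive.
rewrite -(map_f3_num f) -(map_polyXn f) -!rmorphM -rmorphB.
by rewrite (leq_trans (size_poly _ _)).
Qed.

(** * Approximations from the functional equation *)

(** The k + 1 coefficients of Q are subject to k linear conditions, the
    vanishing of the coefficients of Q N of indices S - k, ..., S - 1. *)
Lemma pade_approx (F : fieldType) (N : {poly F}) (S k : nat) : (k <= S)%N ->
  exists Q P : {poly F}, [/\ Q != 0, (size Q <= k.+1)%N &
    (size (Q * N - 'X^S * P)%R <= S - k)%N].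
Proof.
move=> kS.
pose M : 'M[F]_(k.+1, k) := \matrix_(i, j) ('X^i * N)`_(S - k + j).
have : kermx M != 0.
  rewrite kermx_eq0 /row_free; apply/eqP => E.
  by have := rank_leq_col M; rewrite E ltnn.
case/rowV0Pn => v /sub_kermxP vM v0.
exists (rVpoly v), (drop_poly S (rVpoly v * N)); split.
- by apply: contraNneq v0 => E; rewrite -[v]rVpolyK E linear0.
- exact: size_poly.
apply/leq_sizeP => i le_i.
rewrite coefB coefXnM coef_drop_poly; case: ltnP => [lt_i|ge_i]; last first.
  by rewrite subnK // subrr.
have lt_ik : (i - (S - k) < k)%N by lia.
have := congr1 (fun A : 'rV_k => A 0 (Ordinal lt_ik)) vM.
rewrite !mxE subr0 => {2}<-.
have -> : rVpoly v = \sum_(j < k.+1) v 0 j *: 'X^j.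
  rewrite /rVpoly poly_def; apply: eq_bigr => j _.
  by rewrite insubT //= => lt_j; congr (v 0 _ *: _); apply: val_inj.
rewrite mulr_suml coef_sum; apply: eq_bigr => j _.
by rewrite mxE -scalerAl coefZ subnKC.
Qed.

(** Substituting x^3 in an approximation of x^-1 f_3 and applying the
    functional equation gives a numerator divisible by x, so that the division
    by x needed to reach g_3 = x^-1 (x^-1 f_3) leaves the denominator alone
    and gains one order of approximation. *)
Lemma mahler_approx (F : fieldType) (m k : nat) : (k <= sum_pow3 m)%N ->
  exists Q P : {poly F}, [/\ Q != 0, (size Q <= 3 * k + 1)%N &
    (size (Q * f3_num F m.+1 - 'X^(sum_pow3 m.+1 + 2) * P)%R
       <= sum_pow3 m.+1 + 1 - 3 * k)%N].
Proof.
move=> kS; have [Q [P [Q0 sQ sT]]] := pade_approx (f3_num F m) (leqW kS).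
have sX3 : size ('X^3 : {poly F}) = 4%N by rewrite size_polyXn.
exists (Q \Po 'X^3), (('X - 1) * (P \Po 'X^3)); split.
- by rewrite comp_poly_eq0 // sX3.
- have := size_comp_poly_leq Q 'X^3; rewrite sX3.
  by move: (size _) (size Q) sQ; clear; lia.
have ES : sum_pow3 m.+1 = (3 * sum_pow3 m + 1)%N.
  by have := sum_pow3E m; have := sum_pow3E m.+1; rewrite expnS; lia.
have -> : (Q \Po 'X^3) * f3_num F m.+1
   - 'X^(sum_pow3 m.+1 + 2) * (('X - 1) * (P \Po 'X^3)) =
   ('X - 1) * ((Q * f3_num F m - 'X^((sum_pow3 m).+1) * P) \Po 'X^3).
  rewrite f3_num_comp ES comp_polyB !comp_polyM comp_Xn_poly -exprM.
  have -> : (3 * sum_pow3 m + 1 + 2 = 3 * (sum_pow3 m).+1)%N by lia.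
  ring.
set T := _ - _ in sT *.
have [->|T0] := eqVneq T 0; first by rewrite comp_poly0 mulr0 size_poly0.
rewrite ES; have := size_polyMleq ('X - 1) (T \Po 'X^3).
have := size_comp_poly_leq T 'X^3; rewrite sX3 size_XsubC.
have := T0; rewrite -size_poly_gt0.
move: (size (('X - 1) * _)) (size (T \Po _)) (size T) sT => u v w.
by move: kS; clear; lia.
Qed.

(** Two good approximations of the same series are equal as fractions: the
    cross difference is a combination of the two remainders, whose degree is
    smaller than that of the factor x^s it must contain. *)
Lemma approx_proportional (F : fieldType) (N Q P q p : {poly F}) (s u v : nat) :
  (size Q + v <= s.+1)%N -> (size q + u <= s.+1)%N ->
  (size (Q * N - 'X^s * P)%R <= u)%N -> (size (q * N - 'X^s * p)%R <= v)%N ->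
  Q * p = P * q.
Proof.
move=> lQ lq lT lt; apply/eqP; rewrite -subr_eq0 -size_poly_eq0 -leqn0.
apply: (@size_mulXn_leq _ s); rewrite addn0.
have -> : 'X^s * (Q * p - P * q) =
  q * (Q * N - 'X^s * P) - Q * (q * N - 'X^s * p) by ring.
rewrite (leq_trans (size_polyD _ _)) // geq_max size_polyN.
rewrite !(leq_trans (size_polyMleq _ _)) // -ltnS.
  by move: lQ lt; move: (size _) (size _); lia.
by move: lq lT; move: (size _) (size _); lia.
Qed.

(** A reduced fraction that approximates g_3 as well as a convergent has a
    denominator dividing that of [mahler_approx], of degree at most 3k. *)
Lemma coprime_approx_size (F : fieldType) (m k : nat) (q p : {poly F}) :
  (k <= sum_pow3 m)%N -> (3 * k <= sum_pow3 m.+1)%N -> coprimep p q ->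
  size q = (3 * k + 2)%N ->
  (size (q * f3_num F m.+1 - 'X^(sum_pow3 m.+1 + 2) * p)%R
     <= sum_pow3 m.+1 + 1 - 3 * k)%N -> False.
Proof.
move=> kS kS' cop sq lt.
have [Q [P [Q0 sQ lT]]] := mahler_approx F kS.
have E : Q * p = P * q by apply: approx_proportional lT lt; lia.
have : q %| Q.
  by rewrite coprimep_sym in cop; rewrite -(Gauss_dvdpl _ cop) E dvdp_mull.
by move/(dvdp_leq Q0); rewrite sq; move: sQ; clear; move: (size _); lia.
Qed.

(** * Continuants *)

(** The linear recurrence of continued fractions on a pair of consecutive
    terms: [w] holds the terms of indices 0 and -1. *)
Fixpoint continuant (R : nzRingType) (A : nat -> R) (w : R * R) (t : nat) :
    R * R :=
  if t is t'.+1
  then let c := continuant A w t' in (A t * c.1 + c.2, c.1) else w.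

Definition cnum (R : nzRingType) (A : nat -> R) t :=
  (continuant A (A 0%N, 1) t).1.
Definition cden (R : nzRingType) (A : nat -> R) t :=
  (continuant A (1, 0) t).1.

Definition cfstep (R : nzRingType) (a : R) (w : R * R) : R * R :=
  (a * w.1 + w.2, w.1).

(** A finite continued fraction is a product of matrices (a_i 1; 1 0).
    [contfrac] evaluates it from the right and [continuant] from the left. *)
Lemma foldr_cfstep (R : comNzRingType) (A : nat -> R) t (u v : R) :
  foldr (@cfstep R) (u, v) [seq A i | i <- iota 0 t.+1] =
  (let p := continuant A (A 0%N, 1) t in let q := continuant A (1, 0) t in
   (p.1 * u + p.2 * v, q.1 * u + q.2 * v)).
Proof.
elim: t u v => [|t IH] u v.
  by rewrite /= /cfstep /= mul1r mul1r mul0r addr0.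
have -> : iota 0 t.+2 = rcons (iota 0 t.+1) t.+1.
  by rewrite -[t.+2]addn1 iotaD cats1.
rewrite map_rcons foldr_rcons [cfstep _ _]/= IH /=; congr pair; ring.
Qed.

Lemma size_mulDl (F : fieldType) (a b c : {poly F}) :
  (1 < size a)%N -> (size c < size b)%N ->
  size (a * b + c) = (size a + size b).-1.
Proof.
move=> sa lt_c.
have a0 : a != 0 by rewrite -size_poly_gt0 (leq_trans _ sa).
have b0 : b != 0 by rewrite -size_poly_gt0 (leq_ltn_trans _ lt_c).
rewrite size_polyDl size_mul //.
by move: sa lt_c; move: (size _) (size b) (size c); clear; lia.
Qed.

Lemma size_foldr_cfstep (F : fieldType) (s : seq {poly F}) :
  all (fun a : {poly F} => 1 < size a)%N s ->
  let w := foldr (@cfstep _) (1, 0) s in (size w.2 < size w.1)%N.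
Proof.
elim: s => [|a s IH] /=; first by rewrite size_poly0 size_poly1.
case/andP=> sa /IH; set w := foldr _ _ _ => /= lt_w.
rewrite size_mulDl //.
by move: sa lt_w; move: (size _) (size w.1) (size w.2); clear; lia.
Qed.

(** The empty continued fraction is 0 = 1/0, the pair (1, 0).  The degree
    hypothesis keeps the intermediate tails away from 0, where the convention
    0^-1 = 0 would break the recurrence. *)
Lemma contfrac_cfstep (F L : fieldType) (f : {rmorphism {poly F} -> L})
    (a : {poly F}) (s : seq {poly F}) : injective f ->
  all (fun a : {poly F} => 1 < size a)%N s ->
  contfrac (map f (a :: s)) =
  (let w := foldr (@cfstep _) (1, 0) (a :: s) in f w.1 / f w.2).
Proof.
move=> fI; elim: s a => [|b s IH] a /=.
  by rewrite invr0 addr0 mulr1 addr0 rmorph1 divr1.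
case/andP=> sb hs; have := IH b hs; rewrite /= => ->.
have /= := @size_foldr_cfstep F (b :: s) _; rewrite /= sb => /(_ hs).
set w := foldr _ _ _ => lt_w.
have w0 : f (b * w.1 + w.2) != 0.
  by rewrite -(rmorph0 f) (inj_eq fI) -size_poly_gt0 (leq_ltn_trans _ lt_w).
rewrite invf_div; move: (b * w.1 + w.2) w0 => z w0.
by rewrite rmorphD rmorphM /= mulrDl mulfK.
Qed.

Section Continuants.
Variables (F : fieldType) (A : nat -> {poly F}).
Hypothesis hA : forall i, (0 < i)%N -> (1 < size (A i))%N.
Local Notation p := (cnum A).
Local Notation q := (cden A).

Lemma cnumS t : p t.+2 = A t.+2 * p t.+1 + p t. Proof. by []. Qed.
Lemma cdenS t : q t.+2 = A t.+2 * q t.+1 + q t. Proof. by []. Qed.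
Lemma cnum1 : p 1 = A 1%N * A 0%N + 1. Proof. by []. Qed.
Lemma cden0 : q 0 = 1. Proof. by []. Qed.
Lemma cnum0 : p 0 = A 0%N. Proof. by []. Qed.
Lemma cden1 : q 1 = A 1%N. Proof. by rewrite /cden /= mulr1 addr0. Qed.

Lemma size_cden_lt t : (size (q t) < size (q t.+1))%N.
Proof.
elim: t => [|t lt_q]; first by rewrite cden0 cden1 size_poly1 hA.
have sA := hA (ltn0Sn t.+1); rewrite cdenS (size_mulDl sA lt_q).
by move: sA lt_q; move: (size (q t)) (size (q t.+1)) (size (A _)); clear; lia.
Qed.

Lemma size_cden_gt0 t : (0 < size (q t))%N.
Proof.
case: t => [|t]; first by rewrite cden0 size_poly1.
exact: leq_ltn_trans (size_cden_lt t).
Qed.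

Lemma cden_neq0 t : q t != 0.
Proof. by rewrite -size_poly_gt0 size_cden_gt0. Qed.

Lemma size_cden_rec t : size (q t.+1) = (size (A t.+1) + size (q t)).-1.
Proof.
case: t => [|t]; first by rewrite cden1 cden0 size_poly1 addn1.
by rewrite cdenS (size_mulDl (hA (ltn0Sn _)) (size_cden_lt t)).
Qed.

Lemma cont_det t : p t.+1 * q t - p t * q t.+1 = (-1) ^+ t.
Proof.
elim: t => [|t IH]; first by rewrite cnum1 cden0 cnum0 cden1 expr0; ring.
rewrite cnumS cdenS exprS -IH; ring.
Qed.

Lemma coprime_cnum_cden t : coprimep (p t) (q t).
Proof.
apply/Bezout_eq1_coprimepP.
exists (- (-1) ^+ t * q t.+1, (-1) ^+ t * p t.+1) => /=.
transitivity ((-1) ^+ t * (p t.+1 * q t - p t * q t.+1)); first by ring.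
by rewrite cont_det -expr2 -exprM muln2 -signr_odd odd_double.
Qed.

Definition cdiff t T := p T * q t - p t * q T.

(** As a function of T, [cdiff t T] satisfies the same recurrence as q_T, and
    it starts at 0, 1 where q_T starts at q_t, q_(t+1), up to sign.  So it loses
    the degree of q_(t+1): distinct convergents are at distance of order
    deg q_t + deg q_(t+1). *)
Lemma size_cdiff t j :
  (size (cdiff t (t + j).+1) + size (q t.+1) <= size (q (t + j).+1) + 1)%N.
Proof.
suff: (size (cdiff t (t + j).+1) + size (q t.+1) <= size (q (t + j).+1) + 1)%N
  /\ (size (cdiff t (t + j)) + size (q t.+1) <= size (q (t + j).+1) + 1)%N.
  by case.
elim: j => [|j [IH1 IH2]].
  rewrite addn0 /cdiff subrr size_poly0 cont_det -polyC1 -polyCN -rmorphXn.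
  have := size_polyC_leq1 ((-1) ^+ t : F); move: (size _%:P) (size (q _)).
  by clear; lia.
rewrite addnS; split; last first.
  by rewrite (leq_trans IH1) // leq_add2r ltnW // size_cden_lt.
have -> : cdiff t (t + j).+2 =
    A (t + j).+2 * cdiff t (t + j).+1 + cdiff t (t + j).
  by rewrite /cdiff cnumS cdenS; ring.
have := size_cden_rec (t + j).+1; have := size_cden_gt0 (t + j).+1.
have := size_polyMleq (A (t + j).+2) (cdiff t (t + j).+1).
have := size_polyD (A (t + j).+2 * cdiff t (t + j).+1) (cdiff t (t + j)).
have := hA (ltn0Sn (t + j).+1); move: IH1 IH2.
move: (size (_ + cdiff _ _)) (size (A _ * _)).
move: (size (cdiff _ _)) (size (cdiff _ _)).
move: (size (A _)) (size (q _)) (size (q _)) (size (q _)); clear=> *; lia.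
Qed.
End Continuants.

(** * Polynomials inside Laurent series *)

Section Laurent.
Variable K : fieldType.

Definition lauC : {rmorphism K -> laurent K} :=
  (@tofrac (fps K) \o @fps_of_poly K) \o @polyC K.

Definition lau_poly : {rmorphism {poly K} -> laurent K} :=
  horner_eval (lauX K) \o map_poly lauC.

Lemma lau_of_polyE P : lau_of_poly P = lau_poly P.
Proof.
rewrite /lau_of_poly /lau_poly /= /horner_eval; congr (_.[_]).
apply: eq_map_poly => c /=; rewrite /lau_of_fps; congr tofrac.
by apply: fpsP => n /=; rewrite coefC.
Qed.

Lemma lau_of_fps_inj : injective (@lau_of_fps K).
Proof. by move=> f g /eqP; rewrite /lau_of_fps tofrac_eq => /eqP. Qed.

Lemma lau_fpsM f g :
  lau_of_fps (f * g) = lau_of_fps f * lau_of_fps g :> laurent K.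
Proof. by rewrite /lau_of_fps rmorphM. Qed.

Lemma lau_fpsD f g :
  lau_of_fps (f + g) = lau_of_fps f + lau_of_fps g :> laurent K.
Proof. by rewrite /lau_of_fps rmorphD. Qed.

Lemma lau_fpsB f g :
  lau_of_fps (f - g) = lau_of_fps f - lau_of_fps g :> laurent K.
Proof. by rewrite /lau_of_fps rmorphB. Qed.

Lemma fpsY_neq0 : fpsY K != 0.
Proof.
by apply/eqP => /(congr1 (fun f : fps K => f 1%N)) /= /eqP; rewrite oner_eq0.
Qed.

Lemma lauX_neq0 : lauX K != 0.
Proof.
rewrite invr_eq0 -[0]/(lau_of_fps 0) (inj_eq lau_of_fps_inj).
exact: fpsY_neq0.
Qed.

Lemma lau_fpsYn n : lau_of_fps (fpsY K ^+ n) = lauX K ^- n.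
Proof. by rewrite /lauX -exprVn invrK /lau_of_fps rmorphXn. Qed.

Lemma lau_of_fps_poly n (E : nat -> K) :
  lau_of_fps (fps_of_poly (\poly_(i < n) E i)) =
  \sum_(i < n) lauC (E i) * lauX K ^- i.
Proof.
rewrite poly_def /lau_of_fps !rmorph_sum /=; apply: eq_bigr => i _.
by rewrite -mul_polyC !rmorphM /= rmorphXn /= fps_of_polyX -lau_fpsYn.
Qed.

(** The polynomial x^n P(1/x) in the variable y = 1/x. *)
Definition fps_rev (n : nat) (P : {poly K}) : fps K :=
  fps_of_poly (\poly_(i < n.+1) P`_(n - i)).

Lemma lau_poly_rev n (P : {poly K}) : (size P <= n.+1)%N ->
  lau_poly P = lau_of_fps (fps_rev n P) * lauX K ^+ n.
Proof.
move=> sP.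
have -> : lau_poly P = \sum_(i < n.+1) lauC P`_i * lauX K ^+ i.
  rewrite /lau_poly /= /horner_eval (@horner_coef_wide _ n.+1); last first.
    by rewrite (leq_trans (size_poly _ _)).
  by apply: eq_bigr => i _; rewrite coef_map.
rewrite /fps_rev lau_of_fps_poly mulr_suml.
rewrite (reindex_inj rev_ord_inj) /=; apply: eq_bigr => i _.
rewrite subSS -mulrA; congr (_ * _).
have le_i : (i <= n)%N by rewrite -ltnS.
move: (nat_of_ord i) le_i => j le_j.
by rewrite -{2}(subnKC le_j) exprD mulKf ?expf_neq0 ?lauX_neq0.
Qed.

(** A polynomial of order at least -e has degree at most e: otherwise the
    constant coefficient of its reversal, which is its leading coefficient,
    would vanish. *)
Lemma size_lau_poly (h : fps K) e (W : {poly K}) :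
  lau_poly W = lau_of_fps h * lauX K ^+ e -> (size W <= e.+1)%N.
Proof.
move=> E; case: ltnP => // lt_e.
have [k Ek] : exists k, size W = (e + k.+2)%N by exists (size W - e.+2)%N; lia.
rewrite (@lau_poly_rev (e + k.+1)) in E; last by rewrite Ek addnS.
have {}E : fps_rev (e + k.+1) W = fpsY K ^+ k.+1 * h.
  apply: lau_of_fps_inj; rewrite lau_fpsM.
  have X0 n : lauX K ^+ n != 0 by rewrite expf_neq0 ?lauX_neq0.
  apply: (mulIf (X0 (e + k.+1)%N)).
  by rewrite E lau_fpsYn addnC exprD -mulrA mulrCA mulKf.
have := congr1 (fun f : fps K => f 0%N) E.
rewrite fps_coefYnM /= coef_poly /= subn0 => W0.
have : lead_coef W != 0 by rewrite lead_coef_eq0 -size_poly_gt0 Ek addnS.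
by rewrite lead_coefE Ek addnS /= W0 eqxx.
Qed.

Lemma lau_poly_inj : injective lau_poly.
Proof.
move=> P Q E; apply/eqP; rewrite -subr_eq0; apply/eqP.
(* The factor 'X makes the degree bound 0 contradictory. *)
have EW : lau_poly ((P - Q) * 'X) = lau_of_fps 0 * lauX K ^+ 0.
  by rewrite rmorphM rmorphB E subrr mul0r /lau_of_fps rmorph0 mul0r.
have [//|W0] := eqVneq (P - Q) 0.
have := size_lau_poly EW.
by rewrite size_mulX // ltnS leqn0 size_poly_eq0 (negPf W0).
Qed.

Lemma convergentE (A : nat -> {poly K}) t :
  (forall i, (0 < i)%N -> (1 < size (A i))%N) ->
  convergent A t = lau_poly (cnum A t) / lau_poly (cden A t).
Proof.
move=> hA; rewrite /convergent.
have -> : [seq lau_of_poly (A i) | i <- iota 0 t.+1] =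
  map lau_poly [seq A i | i <- iota 0 t.+1].
  by rewrite -map_comp; apply: eq_map => i /=; rewrite lau_of_polyE.
have sA : all (fun a : {poly K} => 1 < size a)%N [seq A i | i <- iota 1 t].
  by apply/allP => a /mapP[i]; rewrite mem_iota => /andP[i0 _] ->; exact: hA.
rewrite [LHS](contfrac_cfstep (A 0%N) lau_poly_inj sA).
rewrite -[A 0%N :: _]/([seq A i | i <- iota 0 t.+1]) foldr_cfstep.
by move: lau_poly => f; rewrite /= !(mulr1, mulr0, addr0).
Qed.
End Laurent.

Lemma lau_polyX (K : fieldType) : lau_poly K 'X = lauX K.
Proof. by rewrite /= /horner_eval map_polyX hornerX. Qed.

Lemma lau_poly_f3_num m : \prod_(0 <= t < m) (1 - lauX rat ^- (3 ^ t)) =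
  lau_poly _ (f3_num rat m) * lauX rat ^- sum_pow3 m.
Proof.
elim: m => [|m IH].
  by rewrite /f3_num /sum_pow3 !big_geq // rmorph1 expr0 invr1 mulr1.
have aux (F : fieldType) (N x y : F) : x != 0 -> y != 0 ->
  N * x^-1 * (1 - y^-1) = N * (y - 1) * (x * y)^-1.
  by move=> x0 y0; field; rewrite x0 y0.
rewrite big_nat_recr // IH f3_numS sum_pow3S exprD.
have -> : lau_poly _ (f3_num rat m * ('X^(3 ^ m) - 1)) =
    lau_poly _ (f3_num rat m) * (lauX rat ^+ (3 ^ m) - 1).
  by rewrite rmorphM rmorphB rmorph1 rmorphXn lau_polyX.
apply: aux; apply: expf_neq0; exact: lauX_neq0.
Qed.

(** Here pT/qT is a convergent so far along the expansion that it agrees with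
    g_3 = x^-2 f up to x^-N, and N xs^-1 is a truncated product that agrees with
    f up to x^-N; x^N, x^c and x^S are abstracted as xN, xc and xs.  The left
    side is a polynomial, whose degree the right side bounds. *)
Lemma remainder_telescope (F : fieldType)
    (x xs xN xc qT pT qt pt N f h r u w : F) :
  x != 0 -> xs != 0 -> xN != 0 -> qT != 0 ->
  x ^- 2 * f - pT / qT = h * xN^-1 -> f - N * xs^-1 = r * xN^-1 ->
  pT * qt - pt * qT = u * xc -> qt * qT = w * (xN * xc) ->
  qT * (qt * N - xs * x ^+ 2 * pt) =
  (u + h * w - r * w * x ^- 2) * (xs * x ^+ 2 * xc).
Proof.
move=> x0 xs0 xN0 qT0 H1 H2 H3 H4.
have Ef : f = x ^+ 2 * (pT / qT + h * xN^-1).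
  by rewrite -H1; field; rewrite x0 qT0.
have EN : N = xs * (f - r * xN^-1) by rewrite -H2; field.
have -> : qT * (qt * N - xs * x ^+ 2 * pt) =
  qt * qT * N - xs * x ^+ 2 * (pt * qT) by ring.
have -> : pt * qT = pT * qt - u * xc by rewrite -H3; ring.
rewrite EN Ef.
have -> : qt * qT * (xs * (x ^+ 2 * (pT / qT + h / xN) - r / xN)) =
  xs * x ^+ 2 * (pT * qt) + qt * qT * (xs * (x ^+ 2 * (h / xN) - r / xN)).
  by field; rewrite xN0 qT0.
by rewrite H4; field; rewrite xN0 x0.
Qed.

(** The remainder q_t g_3 - p_t is of order at least deg q_(t+1).  This is
    read off on q_T times the remainder, for a convergent p_T/q_T close enough
    to g_3, so that only polynomials have to be inverted. *)
Lemma cf_approx (A : nat -> {poly rat}) t : cf_expansion g3 A ->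
  exists M, forall m, (M <= m)%N ->
   (size (cden A t * f3_num rat m - 'X^(sum_pow3 m + 2) * cnum A t)%R
     + size (cden A t.+1) <= sum_pow3 m + 4)%N.
Proof.
case=> hA cvgA; set q := cden A; set p := cnum A.
have q_gt0 := size_cden_gt0 hA.
pose N := ((size (q t)).-1 + (size (q t.+1)).-1)%N.
have [T0 /(_ _ (leq_addl t.+1 T0))[h]] := cvgA N.
rewrite addSn (convergentE _ hA); set T := (t + T0).+1 => Eh.
have [M HM] := f3_cvg N.
exists (maxn M (size (q t.+1))) => m; rewrite geq_max => /andP[/HM[r]].
rewrite lau_poly_f3_num => Er le_m.
pose c := ((size (q T)).-1 - (size (q t.+1)).-1)%N.
have leq_T : (size (q t.+1) <= size (q T))%N.
  rewrite /T; elim: (T0) => [|j IH]; first by rewrite addn0.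
  by rewrite addnS (leq_trans IH) // ltnW // size_cden_lt.
have Eu :
    lau_poly _ (p T) * lau_poly _ (q t) - lau_poly _ (p t) * lau_poly _ (q T) =
    lau_of_fps (fps_rev c (cdiff A t T)) * lauX rat ^+ c.
  rewrite -lau_poly_rev; first by rewrite /cdiff rmorphB !rmorphM.
  have := size_cdiff hA t T0; rewrite -/q -/T; have := q_gt0 t.+1; rewrite -/q.
  rewrite /c; move: leq_T.
  by move: (size (cdiff _ _ _)) (size _) (size (q T)); clear; lia.
have Ew : lau_poly _ (q t) * lau_poly _ (q T) =
    lau_of_fps (fps_rev (N + c) (q t * q T)) * (lauX rat ^+ N * lauX rat ^+ c).
  rewrite -exprD -lau_poly_rev ?rmorphM // (leq_trans (size_polyMleq _ _)) //.
  have := q_gt0 T; have := q_gt0 t.+1; have := q_gt0 t; rewrite -!/q /c /N.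
  by move: leq_T; move: (size _) (size (q t)) (size (q T)); clear; lia.
have X0 n : lauX rat ^+ n != 0 by rewrite expf_neq0 ?lauX_neq0.
have qT0 : lau_poly _ (q T) != 0.
  by rewrite -(rmorph0 (lau_poly rat)) (inj_eq (@lau_poly_inj _)) cden_neq0.
have := remainder_telescope (lauX_neq0 rat) (X0 _) (X0 _) qT0 Eh Er Eu Ew.
rewrite -!exprD -lau_fpsYn -!lau_fpsM -lau_fpsD -lau_fpsB => E.
have : lau_poly _ (q T * (q t * f3_num rat m - 'X^(sum_pow3 m + 2) * p t)) =
  lau_poly _ (q T) * (lau_poly _ (q t) * lau_poly _ (f3_num rat m)
    - lauX rat ^+ (sum_pow3 m + 2) * lau_poly _ (p t)).
  by rewrite !(rmorphM, rmorphB) rmorphXn lau_polyX.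
rewrite E => /size_lau_poly.
set W := _ - _; have [->|W0] := eqVneq W 0.
  rewrite size_poly0 add0n (leq_trans le_m) //.
  by rewrite (leq_trans (leq_sum_pow3 m)) ?leq_addr.
rewrite size_mul ?cden_neq0 //; move: W0; rewrite -size_poly_gt0.
have := q_gt0 T; have := q_gt0 t.+1; rewrite -!/q /c; move: leq_T.
by move: (size W) (size (q T)) (size _); clear; lia.
Qed.

(** * The degrees of the convergents of the Mahler series *)

Lemma size_polyQ P : size (polyQ P) = size P.
Proof. by rewrite /polyQ size_map_inj_poly ?rmorph0 //; exact: intr_inj. Qed.

Lemma reduced_proportional (A : nat -> {poly rat}) t (P Q : {poly int}) :
  (forall i, (0 < i)%N -> (1 < size (A i))%N) -> reduced_convergent A t P Q ->
  exists2 c, c != 0 & polyQ Q = c *: cden A t /\ polyQ P = c *: cnum A t.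
Proof.
move=> hA [Q0 cop E].
have polyQ0 : polyQ Q != 0 by rewrite -size_poly_eq0 size_polyQ size_poly_eq0.
have q0 := cden_neq0 hA t.
have l0 (W : {poly rat}) : W != 0 -> lau_poly _ W != 0.
  by rewrite -(rmorph0 (lau_poly rat)) (inj_eq (@lau_poly_inj _)).
have X : polyQ P * cden A t = cnum A t * polyQ Q.
  apply: (@lau_poly_inj rat); rewrite !rmorphM; apply/eqP.
  by rewrite -eqr_div ?l0 // -convergentE // -E !lau_of_polyE.
have copq := coprime_cnum_cden A t.
have : polyQ Q %= cden A t.
  rewrite coprimep_sym in cop; rewrite coprimep_sym in copq.
  rewrite /eqp -(Gauss_dvdpr _ cop) X dvdp_mull //=.
  by rewrite -(Gauss_dvdpr _ copq) -X dvdp_mull.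
case/eqpf_eq => c c0 Ec; exists c => //; split=> //.
by apply: (mulIf q0); rewrite X Ec -scalerAr scalerAl.
Qed.

(** The pair (P t, Q t) is a constant multiple of the pair of continuants, and
    the remainder is multiplied by the same constant. *)
Lemma reduced_approx (A : nat -> {poly rat}) (P Q : nat -> {poly int}) :
  cf_expansion g3 A -> (forall t, reduced_convergent A t (P t) (Q t)) ->
  forall t, exists M, forall m, (M <= m)%N ->
   (size (Q t * f3_num int m - 'X^(sum_pow3 m + 2) * P t)%R
     + size (Q t.+1) <= sum_pow3 m + 4)%N.
Proof.
move=> hA hPQ t; have [M HM] := cf_approx t hA; exists M => m /HM.
have [c c0 [EQ EP]] := reduced_proportional hA.1 (hPQ t).
have [c' c'0 [EQ' _]] := reduced_proportional hA.1 (hPQ t.+1).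
rewrite -(size_polyQ (Q t.+1)) EQ' size_scale // -(size_polyQ (_ - _)).
rewrite /polyQ rmorphB !rmorphM /= map_polyXn map_f3_num -!/(polyQ _) EQ EP.
by rewrite -scalerAl -scalerAr -scalerBr size_scale.
Qed.

Section Degrees.
Variables (A : nat -> {poly rat}) (P Q : nat -> {poly int}).
Hypothesis hA : cf_expansion g3 A.
Hypothesis hPQ : forall t, reduced_convergent A t (P t) (Q t).

Lemma size_den0 : size (Q 0) = 1%N.
Proof.
have [c c0 [EQ _]] := reduced_proportional hA.1 (hPQ 0).
by rewrite -size_polyQ EQ size_scale // cden0 size_poly1.
Qed.

Lemma size_den_lt t : (size (Q t) < size (Q t.+1))%N.
Proof.
have [c c0 [EQ _]] := reduced_proportional hA.1 (hPQ t).
have [c' c'0 [EQ' _]] := reduced_proportional hA.1 (hPQ t.+1).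
by rewrite -!size_polyQ EQ EQ' !size_scale // (size_cden_lt hA.1).
Qed.

Lemma size_den_gt0 t : (0 < size (Q t))%N.
Proof. by rewrite size_poly_gt0; case: (hPQ t). Qed.

Lemma size_den_gap t n :
  (size (Q t) <= n < (size (Q t.+1)).-1)%N -> (n %% 3 = 1)%N.
Proof.
case/andP=> le_n lt_n; have [M HM] := reduced_approx hA hPQ t.
have Q0 : Q t != 0 by case: (hPQ t).
have := HM _ (leq_maxl M n).
have := leq_trans (leq_maxr M n) (leq_sum_pow3 (maxn M n)).
move: (maxn M n) => m nS le.
apply: (@excess_approx_int m n (Q t) (P t) nS Q0 le_n).
move: le lt_n; move: (size (polyseq (_ - _))) (size (Q t.+1)) => s d.
by move: (sum_pow3 m) nS => S; clear; lia.
Qed.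

Lemma size_den_not_1mod3 t : ((size (Q t)).-1 %% 3 != 1)%N.
Proof.
apply/eqP => E; have [k Ek] : exists k, size (Q t) = (3 * k + 2)%N.
  exists ((size (Q t)).-1 %/ 3)%N.
  by move: E; move: (size (Q t)) => s; clear; lia.
have [c c0 [EQ EP]] := reduced_proportional hA.1 (hPQ t).
have [M HM] := reduced_approx hA hPQ t.
pose m := maxn M (3 * k).
have kS : (3 * k <= sum_pow3 m)%N.
  exact: leq_trans (leq_maxr _ _) (leq_sum_pow3 _).
apply: (@coprime_approx_size rat m k (polyQ (Q t)) (polyQ (P t))).
- by move: kS; clear; lia.
- by rewrite (leq_trans kS) // sum_pow3S leq_addr.
- by case: (hPQ t).
- by rewrite size_polyQ.
have /HM := leqW (leq_maxl M (3 * k)); rewrite -/m.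
rewrite -(size_polyQ (_ - _)) /polyQ rmorphB !rmorphM /= map_polyXn map_f3_num.
have := size_den_lt t; rewrite Ek.
move: (size (polyseq (_ - _))) (size (Q _)) kS.
by move: (sum_pow3 _); clear; lia.
Qed.

(** Since no degree is 1 modulo 3 and only such numbers are skipped, a degree
    divisible by 3 is followed by itself plus 2, and a degree 2 modulo 3 by
    itself plus 1. *)
Lemma size_den_even t : ~~ odd t ->
  ((size (Q t)).-1 %% 3 = 0)%N /\ ((size (Q t)).+2 <= size (Q t.+1))%N.
Proof.
have step0 s : ((size (Q s)).-1 %% 3 = 0)%N -> size (Q s.+1) = (size (Q s)).+2.
  have := @size_den_gap s (size (Q s)).+1; have := size_den_not_1mod3 s.+1.
  have := size_den_gt0 s; have := size_den_lt s.
  by move: (size (Q s)) (size (Q s.+1)) => d d'; clear; lia.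
have step2 s : ((size (Q s)).-1 %% 3 = 2)%N -> size (Q s.+1) = (size (Q s)).+1.
  have := @size_den_gap s (size (Q s)).
  have := size_den_gt0 s; have := size_den_lt s.
  by move: (size (Q s)) (size (Q s.+1)) => d d'; clear; lia.
move=> t_even; suff E : ((size (Q t)).-1 %% 3 = 0)%N by rewrite step0.
rewrite -(odd_double_half t) (negPf t_even) add0n.
elim: t./2 => [|s IH]; first by rewrite size_den0.
rewrite doubleS step2 step0 //; have := size_den_gt0 s.*2.
all: by move: (size _) IH => d; clear; lia.
Qed.
End Degrees.

(** * The orbit of cubing near a p-adic root *)

Lemma expnD1_quad (y n : nat) : exists r : nat,
  ((1 + y) ^ n = 1 + n * y + y ^ 2 * r)%N.
Proof.
elim: n => [|n [r IH]]; first by exists 0%N; lia.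
by exists (n + r + y * r)%N; rewrite expnS IH; nia.
Qed.

Lemma expnD1_cubic (y n : nat) : exists r : nat,
  ((1 + y) ^ n = 1 + n * y + 'C(n, 2) * y ^ 2 + y ^ 3 * r)%N.
Proof.
elim: n => [|n [r IH]]; first by exists 0%N; rewrite bin0n; lia.
exists ('C(n, 2) + r + y * r)%N; rewrite expnS IH binS bin1; nia.
Qed.

(** Raising 1 + y to the power p adds exactly one to the valuation of y: in
    the binomial expansion p y dominates, as p divides the coefficient of y^2
    and y^3 has at least two more factors p than y. *)
Lemma val_expp (p i w : nat) : prime p -> odd p -> ~~ (p %| w)%N ->
  exists2 w' : nat,
    ((1 + p ^ i.+1 * w) ^ p = 1 + p ^ i.+2 * w')%N & ~~ (p %| w')%N.
Proof.
move=> p_pr p_odd pw; have [r ->] := expnD1_cubic (p ^ i.+1 * w) p.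
have /dvdnP[c ->] : (p %| 'C(p, 2))%N.
  by apply: prime_dvd_bin => //; have := prime_gt1 p_pr; lia.
exists (w + p * (c * p ^ i * w ^ 2 + p ^ i * p ^ i * w ^ 3 * r))%N.
  by rewrite !expnS !expn0; ring.
by rewrite dvdn_addl ?dvdn_mulr.
Qed.

Lemma val_exppn (p w k : nat) : prime p -> odd p -> ~~ (p %| w)%N ->
  exists2 w' : nat,
    ((1 + p * w) ^ (p ^ k) = 1 + p ^ k.+1 * w')%N & ~~ (p %| w')%N.
Proof.
move=> p_pr p_odd pw; elim: k => [|k [w' E pw']].
  by exists w; rewrite ?expn1.
have [w'' E' pw''] := val_expp k p_pr p_odd pw'.
by exists w''; rewrite // expnSr expnM E E'.
Qed.

Lemma horner_taylor1 (R : comNzRingType) (Q : {poly R}) (x h : R) :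
  exists r, Q.[x + h] = Q.[x] + h * r.
Proof.
elim/poly_ind: Q => [|Q c [r IH]]; first by exists 0; rewrite !horner0; ring.
by exists (r * (x + h) + Q.[x]); rewrite !hornerMXaddC IH; ring.
Qed.

Lemma horner_taylor2 (R : comNzRingType) (Q : {poly R}) (x h : R) :
  exists r, Q.[x + h] = Q.[x] + h * Q^`().[x] + h ^+ 2 * r.
Proof.
elim/poly_ind: Q => [|Q c [r IH]].
  by exists 0; rewrite deriv0 !horner0; ring.
exists (Q^`().[x] + r * (x + h)).
have -> : (Q * 'X + c%:P)^`().[x] = Q^`().[x] * x + Q.[x].
  by rewrite derivD derivC derivM derivX addr0 mulr1 hornerD hornerM hornerX.
by rewrite !hornerMXaddC IH; ring.
Qed.

Lemma solve_mod (p : nat) (c g : int) (N : nat) : prime p -> ~~ (p %| g)%Z ->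
  exists2 j : nat, (N <= j)%N & (p %| c + j%:Z * g)%Z.
Proof.
move=> p_pr pg; have p_gt0 := prime_gt0 p_pr.
have : coprimez p g by rewrite coprimezE absz_nat prime_coprime // -dvdzE.
case/coprimezP => -[s t] /= st.
exists (`|(- c * t) %% p|%Z + p * N)%N.
  by rewrite (leq_trans (leq_pmull N p_gt0)) // leq_addl.
have p0 : p%:Z != 0 by rewrite eqz_nat -lt0n.
rewrite PoszD PoszM gez0_abs ?modz_ge0 //.
have := divz_eq (- c * t) p; move: (_ %% _)%Z (_ %/ _)%Z => m q Em.
have {Em}-> : m = - c * t - q * p by rewrite Em; ring.
have -> : c + (- c * t - q * p + p%:Z * N) * g =
   p%:Z * (c * s + (N%:Z - q) * g) + c * (1 - (s * p + t * g)) by ring.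
by rewrite st subrr mulr0 addr0 dvdz_mulr.
Qed.

Section PadicOrbit.
Variables (Q : {poly int}) (p b o w u : nat).
Hypotheses (p_pr : prime p) (p_odd : odd p) (p_neq3 : p != 3).
Hypotheses (Eb : b = (1 + p * w)%N) (pw : ~~ (p %| w)%N).
Hypotheses (Eo : (3 ^ o)%N = (1 + p * u)%N) (pu : ~~ (p %| u)%N).
Hypothesis (dQ1 : ~~ (p %| Q^`().[1])%Z).

Lemma orbit_val1 n : exists2 w', (b ^ (3 ^ n) = 1 + p * w')%N & ~~ (p %| w')%N.
Proof.
have [r E] := expnD1_quad (p * w) (3 ^ n).
exists (3 ^ n * w + p * (w ^ 2 * r))%N.
  by rewrite Eb E; ring.
rewrite dvdn_addl; last exact: dvdn_mulr.
rewrite Euclid_dvdM // negb_or pw andbT.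
by rewrite Euclid_dvdX // (dvdn_prime2 p_pr) // negb_and p_neq3.
Qed.

(** Newton's method along the orbit of cubing.  Multiplying the exponent by
    3^(o p^k j), which is 1 modulo p^(k+1), multiplies B = b^(3^n) by a power
    of B^(p^(k+1)) and so moves it by p^(k+2) times any chosen residue modulo p,
    as j varies.  Since Q'(1) is a unit modulo p, one residue corrects Q(B) to
    the next power of p. *)
Lemma hensel_step k n N :
  ((p ^ k.+2)%N %| Q.[(b ^ (3 ^ n))%N%:Z])%Z ->
  exists2 n', (N <= n')%N & ((p ^ k.+3)%N %| Q.[(b ^ (3 ^ n'))%N%:Z])%Z.
Proof.
case/dvdzP => c Ec.
have [w1 EB pw1] := orbit_val1 n.
have [u1 E3 pu1] := val_exppn k p_pr p_odd pu.
have [v Ev pv] := val_exppn k.+1 p_pr p_odd pw1.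
set B := (b ^ (3 ^ n))%N in Ec EB.
pose g := (u1 * v)%N%:Z * Q^`().[1].
have pg : ~~ (p %| g)%Z.
  rewrite /g !dvdzE abszM absz_nat !Euclid_dvdM // !negb_or pu1 pv /=.
  by have := dQ1; rewrite dvdzE absz_nat.
have [j leN hj] := solve_mod c N p_pr pg.
have o_gt0 : (0 < o)%N.
  case: (posnP o) => // o0; move: Eo; rewrite o0 expn0 => /eqP.
  rewrite -[X in X == _]addn0 eqn_add2l eq_sym muln_eq0 => /orP[] /eqP z.
    by move: (prime_gt0 p_pr); rewrite z.
  by move: pu; rewrite z dvdn0.
exists (n + o * p ^ k * j)%N.
  rewrite (leq_trans leN) // (leq_trans _ (leq_addl _ _)) // leq_pmull //.
  by rewrite muln_gt0 o_gt0 expn_gt0 prime_gt0.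
have [r1 Er1] := expnD1_quad (p ^ k.+1 * u1) j.
pose e := (j * u1 + p * (p ^ k * u1 ^ 2 * r1))%N.
have Ee : (3 ^ (o * p ^ k * j) = 1 + p ^ k.+1 * e)%N.
  by rewrite !expnM Eo E3 Er1 /e !expnS; ring.
have [r2 Er2] := expnD1_quad (p ^ k.+2 * v) e.
pose h := (B * (e * v + p * (p ^ k.+1 * v ^ 2 * r2)))%N.
have Eh : (b ^ (3 ^ (n + o * p ^ k * j)) = B + p ^ k.+2 * h)%N.
  rewrite expnD expnM -/B Ee expnD expn1 expnM {2}EB Ev Er2 /h !expnS; ring.
rewrite Eh PoszD.
have [r3 ->] := horner_taylor2 Q B%:Z (p ^ k.+2 * h)%N%:Z.
have [r4 Er4] := horner_taylor1 Q^`() 1 (p * w1)%N%:Z.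
have EQ' : Q^`().[B%:Z] = Q^`().[1] + (p * w1)%N%:Z * r4 by rewrite EB PoszD.
(* The displacement h is j u1 v modulo p, since B is 1 modulo p. *)
have [z Ez] : exists z : nat, (h = j * (u1 * v) + p * z)%N.
  exists (p ^ k * u1 ^ 2 * r1 * v + p ^ k.+1 * v ^ 2 * r2 +
          w1 * (e * v + p * (p ^ k.+1 * v ^ 2 * r2)))%N.
  by rewrite /h EB /e; ring.
have /dvdzP[y Ey] := hj.
rewrite Ec EQ'; apply/dvdzP; clearbody h.
pose s := h%:Z * w1%:Z * r4 + (p ^ k.+1)%N%:Z * h%:Z ^+ 2 * r3.
exists (y + z%:Z * Q^`().[1] + s).
have Ez1 : c + h%:Z * Q^`().[1] = (c + j%:Z * g) + p%:Z * (z%:Z * Q^`().[1]).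
  by rewrite Ez /g !(PoszM, PoszD); ring.
transitivity ((p ^ k.+2)%N%:Z * (c + h%:Z * Q^`().[1] + p%:Z * s)).
  by rewrite /s !expnS !PoszM; ring.
by rewrite Ez1 Ey !expnS !PoszM; ring.
Qed.

Lemma hensel_orbit k N : ((p ^ 2)%N %| Q.[b%:Z])%Z ->
  exists2 n, (N <= n)%N & ((p ^ k)%N %| Q.[(b ^ (3 ^ n))%N%:Z])%Z.
Proof.
move=> h2.
have [n hn] : exists n, ((p ^ k.+2)%N %| Q.[(b ^ (3 ^ n))%N%:Z])%Z.
  elim: k => [|i [n hn]]; first by exists 0%N; rewrite expn0 expn1.
  by have [n' _ hn'] := hensel_step 0 hn; exists n'.
have [n' le_N hn'] := hensel_step N hn; exists n' => //.
by apply: dvdz_trans hn'; rewrite dvdzE !absz_nat dvdn_exp2l //; lia.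
Qed.
End PadicOrbit.

(** When b is invertible modulo m, [Gamma b m] is the cyclic group generated by
    b, and its cardinal is the order of b. *)
Lemma dvdn_card_Gamma (b m k : nat) : (1 < m)%N -> coprime m b ->
  (#|Gamma b m| %| k)%N = (b ^ k == 1 %[mod m]).
Proof.
move=> m1 mb.
have bU : (b%:R : 'Z_m) \is a GRing.unit by rewrite unitZpE.
pose u : {unit 'Z_m} := FinRing.unit 'Z_m bU.
have -> : Gamma b m = <[u]>%g.
  rewrite /Gamma; congr <<_>>%g; apply/setP => v.
  by rewrite !inE -val_eqE.
have -> : (#[u]%g %| k)%N = ((b ^ k)%:R == 1%:R :> 'Z_m).
  by rewrite order_dvdn -val_eqE /= FinRing.val_unitX -natrX.
by rewrite -val_eqE /= val_Zp_nat // Zp_cast.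
Qed.

(** The group of powers of 3 grows by the factor p from modulus p to p^2, so
    the order o of 3 modulo p is not its order modulo p^2. *)
Lemma Gamma_val1 p : prime p -> p != 3 ->
  #|Gamma 3 (p ^ 2)| = (p * #|Gamma 3 p|)%N ->
  exists o u, (3 ^ o = 1 + p * u)%N /\ ~~ (p %| u)%N.
Proof.
move=> p_pr p3 EG; have p1 := prime_gt1 p_pr.
have cop : coprime p 3.
  by rewrite prime_coprime // (dvdn_prime2 p_pr).
set o := #|Gamma 3 p| in EG.
have o0 : (0 < o)%N by apply: cardG_gt0.
have := dvdn_card_Gamma o p1 cop; rewrite dvdnn => /esym.
rewrite eqn_mod_dvd ?expn_gt0 // => /dvdnP[u Eu].
have E3 : (3 ^ o = 1 + p * u)%N by have := expn_gt0 3 o; rewrite mulnC; lia.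
exists o, u; split=> //; apply/negP => /dvdnP[v Ev].
have := @dvdn_card_Gamma 3 (p ^ 2) o _ _; rewrite coprimeXl // EG.
rewrite (@ltn_exp2l _ 0) // => /(_ isT isT).
rewrite eqn_mod_dvd ?expn_gt0 // E3 addKn Ev.
rewrite mulnCA mulnn dvdn_mull // => /(dvdn_leq o0); rewrite leqNgt.
by rewrite ltn_Pmull.
Qed.

(** * Real estimates *)

Section RealSide.
Variable R : realType.
Implicit Types x : R.

Definition fprod x m : R := \prod_(0 <= t < m) (1 - x ^- (3 ^ t)).

Lemma fprodS x m : fprod x m.+1 = fprod x m * (1 - x ^- (3 ^ m)).
Proof. by rewrite /fprod big_nat_recr. Qed.

Lemma fprod_ge0_le1 x m : 1 <= x -> 0 <= fprod x m <= 1.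
Proof.
move=> x1; elim: m => [|m /andP[IH0 IH1]].
  by rewrite /fprod big_geq // ler01 lexx.
have xm : 1 <= x ^+ (3 ^ m) by rewrite exprn_ege1.
have xV : 0 <= x ^- (3 ^ m) <= 1.
  rewrite invr_ge0 invf_le1 ?xm ?(lt_le_trans ltr01) //.
  by rewrite andbT (le_trans ler01).
rewrite fprodS; case/andP: xV => v0 v1.
rewrite mulr_ge0 ?subr_ge0 //= mulr_ile1 ?subr_ge0 //.
by rewrite gerBl.
Qed.

(** The bound telescopes: adding the factor 1 - y^-1 costs at most y^-1, which
    is at most 2 (y^-1 - y^-3) as soon as y >= 2. *)
Lemma fprod_sub x m j : 2 <= x ->
  0 <= fprod x m - fprod x (m + j) <= 2 * (x ^- (3 ^ m) - x ^- (3 ^ (m + j))).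
Proof.
move=> x2; have x1 : 1 <= x by apply: le_trans x2; rewrite ler1n.
elim: j => [|j /andP[IH0 IH1]]; first by rewrite addn0 !subrr mulr0 lexx.
rewrite addnS fprodS expnSr exprM.
have /andP[F0 F1] := fprod_ge0_le1 (m + j) x1.
set y := x ^+ (3 ^ (m + j)) in IH1 *.
have y2 : 2 <= y.
  apply: le_trans x2 _; rewrite -{1}[x]expr1 ler_weXn2l // expn_gt0 //.
clearbody y; have y0 : 0 < y by apply: lt_le_trans y2; rewrite ltr0n.
have vy : y * y^-1 = 1 by rewrite divff // gt_eqF.
have v0 : 0 < y^-1 by rewrite invr_gt0.
have v1 : y^-1 <= 2^-1 by rewrite lef_pV2 // posrE ltr0n.
have v3 : (y ^+ 3)^-1 <= y^-1 / 4%:R.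
  rewrite exprS invfM -exprVn; apply: ler_wpM2l; first exact: ltW.
  apply: (@le_trans _ _ (2^-1 ^+ 2)).
    by rewrite lerXn2r // nnegrE; [exact: ltW|rewrite invr_ge0 ler0n].
  by lra.
have Fv : 0 <= fprod x (m + j) * y^-1 <= y^-1.
  by rewrite mulr_ge0 ?(ltW v0) //= ler_piMl // ltW.
case/andP: Fv => Fv0 Fv1; apply/andP; split; rewrite mulrBr mulr1; lra.
Qed.

Lemma fprodD x m j : fprod x (m + j) = fprod x m * fprod (x ^+ (3 ^ m)) j.
Proof.
elim: j => [|j IH].
  by rewrite addn0 /fprod (@big_geq _ _ _ 0 0) // mulr1.
by rewrite addnS !fprodS IH -exprM -expnD mulrA.
Qed.

Lemma f3_real_tail a m : (2 <= a)%N ->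
  `|fprod a%:R m - f3_real R a| <= 2 * a%:R ^- (3 ^ m).
Proof.
move=> a2; have x2 : 2 <= a%:R :> R by rewrite ler_nat.
have cv := @f3_real_cvg R _ a2.
have x0 n : 0 <= a%:R ^- (3 ^ n) :> R by rewrite invr_ge0 exprn_ge0 // ler0n.
have near_le : \forall n \near \oo%classic,
    fprod a%:R m - 2 * a%:R ^- (3 ^ m) <= fprod a%:R n <= fprod a%:R m.
  exists m => // n /= le_mn; have := fprod_sub m (n - m) x2.
  rewrite subnKC // => /andP[h1 h2]; have := x0 n.
  by move=> h3; apply/andP; split; lra.
have h1 : f3_real R a <= fprod a%:R m.
  by apply: limr_le => //; apply: filterS near_le => n /andP[].
have h2 : fprod a%:R m - 2 * a%:R ^- (3 ^ m) <= f3_real R a.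
  by apply: limr_ge => //; apply: filterS near_le => n /andP[].
rewrite ger0_norm; lra.
Qed.

Lemma f3_realM a m : (2 <= a)%N ->
  f3_real R a = fprod a%:R m * f3_real R (a ^ (3 ^ m)).
Proof.
move=> a2; have am2 : (2 <= a ^ (3 ^ m))%N.
  by rewrite (leq_trans a2) // -{1}[a]expn1 leq_pexp2l ?expn_gt0 // ltnW.
have cv := @f3_real_cvg R _ am2.
apply/cvg_lim => //; rewrite -(cvg_shiftn m) /=.
have -> : (fun n => \prod_(0 <= t < n + m) (1 - a%:R ^- (3 ^ t))) =
   (fun n => fprod a%:R m * fprod (a ^ (3 ^ m))%:R n) :> (nat -> R).
  by apply: funext => n; rewrite -/(fprod _ _) addnC fprodD natrX.
exact: cvgMr.
Qed.

Lemma horner_f3_num a m : (0 < a)%N ->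
  ((f3_num int m).[a%:Z])%:~R = a%:R ^+ sum_pow3 m * fprod a%:R m :> R.
Proof.
move=> a0; elim: m => [|m IH].
  by rewrite /f3_num /fprod /sum_pow3 !big_geq // hornerC mulr1.
rewrite f3_numS hornerM rmorphM /= IH fprodS sum_pow3S exprD.
rewrite !hornerE rmorphB rmorphXn /=.
have X0 : (a%:R : R) ^+ (3 ^ m) != 0 by rewrite expf_neq0 // pnatr_eq0 -lt0n.
by rewrite pmulrn; field.
Qed.

Lemma poly_bound (W : {poly int}) e : (size W <= e.+1)%N ->
  exists2 C : R, 0 <= C & forall x : nat, (1 <= x)%N ->
    `|(W.[x%:Z])%:~R| <= C * x%:R ^+ e.
Proof.
move=> sW; exists (\sum_(i < e.+1) `|(W`_i)%:~R|); first by rewrite sumr_ge0.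
move=> x x1; rewrite (horner_coef_wide _ sW) rmorph_sum /= mulr_suml.
apply: le_trans (ler_norm_sum _ _ _) _; apply: ler_sum => i _.
rewrite rmorphM rmorphXn /= normrM ler_wpM2l // normrX normr_nat.
by rewrite ler_weXn2l ?ler1n // -ltnS.
Qed.

(** By induction on the degree: where Q(x) is nonzero, Q(x) x + c can only
    vanish for x at most |c|. *)
Lemma poly_large_neq0 (W : {poly int}) : W != 0 ->
  exists B : nat, forall x : nat, (B <= x)%N -> W.[x%:Z] != 0.
Proof.
elim/poly_ind: W => [|W c IH]; first by rewrite eqxx.
have [-> c0|W0 _] := eqVneq W 0.
  exists 0%N => x _; rewrite mul0r add0r hornerC.
  by apply: contraNneq c0 => ->; rewrite mul0r add0r.
have [B HB] := IH W0; exists (maxn B `|c|.+1) => x.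
rewrite geq_max hornerMXaddC => /andP[/HB Wx lt_c].
apply/eqP => /eqP; rewrite addr_eq0 => /eqP E.
have := congr1 absz E; rewrite abszM abszN /= => Ea.
have : (x <= `|c|)%N by rewrite -Ea leq_pmull // absz_gt0.
by rewrite leqNgt lt_c.
Qed.

(** When d is the degree of Q, the hypothesis on the remainder says that
    Q g_3 - P is of order d + 2. *)
Lemma real_approx (Q P : {poly int}) (m d : nat) :
  (size Q <= d.+1)%N -> (d <= sum_pow3 m)%N ->
  (size (Q * f3_num int m - 'X^(sum_pow3 m + 2) * P)%R
     <= (sum_pow3 m - d).+1)%N ->
  exists2 C : R, 0 <= C & forall x : nat, (2 <= x)%N ->
    `|(Q.[x%:Z])%:~R * f3_real R x - x%:R ^+ 2 * (P.[x%:Z])%:~R|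
      <= C * x%:R ^- d.
Proof.
move=> sQ dS sT; set S := sum_pow3 m in dS sT *.
have [C1 C10 H1] := poly_bound sT; have [C2 C20 H2] := poly_bound sQ.
exists (C1 + 2 * C2); first by rewrite addr_ge0 // mulr_ge0 // ler0n.
move=> x x2; have x1 := ltnW x2.
have xR : 1 <= x%:R :> R by rewrite ler1n.
have x0 n : 0 < x%:R ^+ n :> R by rewrite exprn_gt0 // ltr0n.
have xn0 n : x%:R ^+ n != 0 :> R by rewrite gt_eqF.
set Qx : R := (Q.[x%:Z])%:~R; set Px : R := (P.[x%:Z])%:~R.
set F := fprod x%:R m; set f := f3_real R x.
have -> : Qx * f - x%:R ^+ 2 * Px =
  (Qx * F - x%:R ^+ 2 * Px) - Qx * (F - f) by ring.
apply: le_trans (ler_normB _ _) _; rewrite mulrDl lerD //.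
  have := H1 x x1; rewrite hornerD hornerN !hornerM hornerXn.
  rewrite rmorphB !rmorphM /= horner_f3_num // rmorphXn /= -/Qx -/Px -/F.
  have -> : Qx * (x%:R ^+ S * F) - x%:~R ^+ (S + 2) * Px =
     x%:R ^+ S * (Qx * F - x%:R ^+ 2 * Px) by rewrite exprD -pmulrn; ring.
  rewrite normrM (ger0_norm (ltW (x0 _))) -(ler_pM2l (x0 S)).
  have -> : x%:R ^+ S * (C1 * x%:R ^- d) = C1 * x%:R ^+ (S - d) :> R.
    by rewrite mulrCA; congr (_ * _); rewrite -[in LHS](subnK dS) exprD mulfK.
  by [].
rewrite normrM.
apply: (@le_trans _ _ ((C2 * x%:R ^+ d) * (2 * x%:R ^- (3 ^ m)))).
  by apply: ler_pM => //; [exact: H2 | exact: f3_real_tail].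
have -> : C2 * x%:R ^+ d * (2 * x%:R ^- (3 ^ m)) =
   2 * C2 * (x%:R ^+ d / x%:R ^+ (3 ^ m)) by ring.
apply: ler_wpM2l; first by rewrite mulr_ge0 // ler0n.
rewrite ler_pdivrMr // mulrC ler_pdivlMr // -exprD ler_weXn2l //.
by rewrite -(sum_pow3E m) -/S; move: dS; clear; lia.
Qed.
End RealSide.

(** * Failure of bad approximability *)

(** Each factor b^(3^t) - 1 with t >= n0 is a multiple of b^(3^n0) - 1. *)
Lemma dvdz_f3_num p b n0 k : (p %| b ^ (3 ^ n0) - 1)%N -> (0 < b)%N ->
  ((p ^ k)%N %| (f3_num int (n0 + k)).[b%:Z])%Z.
Proof.
move=> pb b0; elim: k => [|k IH]; first by rewrite expn0 dvd1z.
rewrite addnS f3_numS hornerM expnSr PoszM dvdz_mul // !hornerE.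
have -> : b%:Z ^+ (3 ^ (n0 + k)) - 1 = ((b ^ (3 ^ n0)) ^ (3 ^ k) - 1)%N%:Z.
  rewrite -expnM -expnD -subzn ?expn_gt0 ?b0 //.
  by rewrite -!natz natrX.
rewrite dvdzE /= (dvdn_trans pb) //.
by rewrite -[X in (_ %| _ - X)%N](exp1n (3 ^ k)) subn_exp dvdn_mulr.
Qed.

(** The fraction r/s is obtained from Q(x) f_3(x) and x^2 P(x), x = a^(3^m), by
    multiplying by [f3_num m](a) / a^S and cancelling the common factor g.  Then
    |s| |s f_3(a) - r| = O(g^-2), with a constant independent of g. *)
Lemma not_badly_approximable (R : realType) (a : nat) (Q P : {poly int})
    (d : nat) (C : R) :
  (2 <= a)%N -> (size Q <= d.+1)%N ->
  (forall x : nat, (2 <= x)%N ->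
    `|(Q.[x%:Z])%:~R * f3_real R x - x%:R ^+ 2 * (P.[x%:Z])%:~R|
      <= C * x%:R ^- d) ->
  (forall K : nat, exists g m : nat, [/\ (K <= g)%N,
     Q.[(a ^ (3 ^ m))%N%:Z] != 0, (g %| Q.[(a ^ (3 ^ m))%N%:Z])%Z &
     (g %| (f3_num int m).[a%:Z])%Z]) ->
  ~ badly_approximable (f3_real R a).
Proof.
move=> a2 sQ HC Hg [c [c0 bad]].
have [C2 C20 H2] := @poly_bound R Q d sQ.
have C0 : 0 <= C.
  have := HC 2%N isT => /(le_trans (normr_ge0 _)).
  by rewrite pmulr_lge0 // invr_gt0 exprn_gt0 // ltr0n.
have [K hK] : exists K : nat, C * C2 / c < K%:R.
  by exists (Num.truncn (C * C2 / c)).+1; rewrite truncnS_gt.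
have [g [m [leK Qx0 /dvdzP[s Es] /dvdzP[n En]]]] := Hg K.+1.
set x := (a ^ (3 ^ m))%N in Qx0 Es.
have x2 : (2 <= x)%N.
  by rewrite (leq_trans a2) // -{1}[a]expn1 leq_pexp2l ?expn_gt0 // ltnW.
have g0 : 0 < g%:R :> R by rewrite ltr0n (leq_trans _ leK).
have s0 : s != 0 by apply: contraNneq Qx0 => s0; rewrite Es s0 mul0r.
have a0 : 0 < a%:R :> R by rewrite ltr0n ltnW.
have ES : (sum_pow3 m <= 2 * 3 ^ m)%N by have := sum_pow3E m; lia.
(* E = x^2 / a^S *)
pose E := (a ^ (2 * 3 ^ m - sum_pow3 m))%N.
pose r : int := n * E%:Z * P.[x%:Z].
have [_] := bad r s s0.
have sR0 : s%:~R != 0 :> R by rewrite intr_eq0.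
have Es' : (Q.[x%:Z])%:~R = s%:~R * g%:R :> R by rewrite Es rmorphM.
have xE : (x%:R : R) = a%:R ^+ (3 ^ m) by rewrite natrX.
have En' : n%:~R * g%:R = a%:R ^+ sum_pow3 m * fprod a%:R m :> R.
  by rewrite -horner_f3_num ?(ltnW a2) // En rmorphM.
have key : g%:R * (s%:~R * f3_real R a - r%:~R) = fprod a%:R m *
    ((Q.[x%:Z])%:~R * f3_real R x - x%:R ^+ 2 * (P.[x%:Z])%:~R).
  have -> : x%:R ^+ 2 = a%:R ^+ sum_pow3 m * E%:R :> R.
    by rewrite xE /E natrX -exprM -exprD subnKC // mulnC.
  transitivity ((s%:~R * g%:R) * f3_real R a -
    (n%:~R * g%:R) * E%:R * (P.[x%:Z])%:~R).
    by rewrite /r !rmorphM /= -pmulrn; ring.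
  by rewrite -Es' En' (f3_realM R m a2) -/x; ring.
move=> hc.
have [F0 F1] : 0 <= fprod (a%:R : R) m /\ fprod (a%:R : R) m <= 1.
  by apply/andP; apply: fprod_ge0_le1; rewrite ler1n ltnW.
have x0 : 0 < x%:R ^+ d :> R by rewrite exprn_gt0 // ltr0n ltnW.
have b1 : g%:R * `|s%:~R * f3_real R a - r%:~R| <= C * x%:R ^- d.
  rewrite -(ger0_norm (ltW g0)) -normrM key normrM ger0_norm //.
  by apply: le_trans (HC x x2); rewrite ler_piMl.
have b2 : `|s%:~R| * g%:R <= C2 * x%:R ^+ d.
  by rewrite -(ger0_norm (ltW g0)) -normrM -Es' H2 // ltnW.
have b3 : c <= `|s%:~R| * `|s%:~R * f3_real R a - r%:~R|.
  have -> : s%:~R * f3_real R a - r%:~R = s%:~R * (f3_real R a - r%:~R / s%:~R).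
    by field.
  rewrite normrM mulrA -normrM -expr2 normrX real_normK ?num_real //.
  by rewrite -ler_pdivrMl ?exprn_even_gt0 // mulrC.
have b4 : g%:R ^+ 2 * c <= C * C2.
  have -> : C * C2 = (C2 * x%:R ^+ d) * (C * x%:R ^- d).
    by field; rewrite gt_eqF.
  apply: le_trans (ler_pM _ _ b2 b1); rewrite ?mulr_ge0 ?(ltW g0) //.
  have -> : `|s%:~R| * g%:R * (g%:R * `|s%:~R * f3_real R a - r%:~R|) =
      g%:R ^+ 2 * (`|s%:~R| * `|s%:~R * f3_real R a - r%:~R|) by ring.
  by rewrite ler_wpM2l // sqr_ge0.
move: hK; rewrite ltr_pdivrMr // => hK.
have b5 : K%:R * c <= g%:R ^+ 2 * c.
  rewrite ler_pM2r // -natrX ler_nat (leq_trans (ltnW leK)) // -{1}[g]expn1.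
  by rewrite leq_pexp2l // (leq_trans _ leK).
by have := lt_le_trans hK b5; rewrite ltNge b4.
Qed.

Theorem theorem4 (R : realType) (a : nat) (ha : (2 <= a)%N)
  (A : nat -> {poly rat}) (hA : cf_expansion g3 A)
  (P Q : nat -> {poly int}) (hPQ : forall t, reduced_convergent A t (P t) (Q t))
  (hyp : exists n0 t p : nat,
    [/\ [/\ (0 < n0)%N, (0 < t)%N & (0 < p)%N],
        [/\ (5 <= p)%N, prime p, (p %| a ^ (3 ^ n0) - 1)%N
          & ~~ (p ^ 2 %| a ^ (3 ^ n0) - 1)%N],
        #|Gamma 3 (p ^ 2)| = (p * #|Gamma 3 p|)%N,
        ~~ odd t /\
          ((Q t).[(a ^ (3 ^ n0))%N%:Z] = 0 %[mod ((p ^ 2)%N : int)])%Z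
      & ((Q t)^`().[1] <> 0 %[mod (p : int)])%Z]) :
  ~ badly_approximable (f3_real R a).
Proof.
case: hyp => n0 [t [p [[_ _ p_gt0] [p5 p_pr pb pb2] EG [t_even Qb] dQ]]].
set b := (a ^ (3 ^ n0))%N in pb pb2 Qb.
have a0 : (0 < a)%N by apply: leq_trans ha.
have b0 : (0 < b)%N by rewrite expn_gt0 a0.
have p3 : p != 3 by apply: contraTneq p5 => ->.
have p_odd : odd p by case: (even_prime p_pr) => // p2; rewrite p2 in p5.
have [w [Eb pw]] : exists w, b = (1 + p * w)%N /\ ~~ (p %| w)%N.
  case/dvdnP: pb => w Ew; exists w; split; first by rewrite mulnC -Ew subnKC.
  by apply: contra pb2 => /dvdnP[v Ev]; rewrite Ew Ev -mulnA mulnn dvdn_mull.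
have [o [u [Eo pu]]] := Gamma_val1 p_pr p3 EG.
have dQ1 : ~~ (p %| (Q t)^`().[1])%Z.
  by apply/negP => /dvdz_mod0P E; apply: dQ; rewrite E mod0z.
have Qb2 : ((p ^ 2)%N %| (Q t).[b%:Z])%Z.
  by apply/dvdz_mod0P; rewrite Qb mod0z.
have [_ sQ] := size_den_even hA hPQ t_even.
have [M HM] := reduced_approx hA hPQ t.
pose d := (size (Q t)).-1; have sQ_gt0 := size_den_gt0 hPQ t.
pose m := maxn M d.+2.
have dS : (d.+2 <= sum_pow3 m)%N.
  exact: leq_trans (leq_maxr _ _) (leq_sum_pow3 _).
have sQd : (size (Q t) <= d.+1)%N by rewrite /d prednK.
have [|C _ HC] := @real_approx R (Q t) (P t) m d sQd (ltnW (ltnW dS)).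
  have := HM m (leq_maxl _ _); rewrite /d; move: dS sQ sQ_gt0; rewrite /d.
  move: (size (polyseq (_ - _))) (size (Q t)) (size (Q t.+1)).
  by move: (sum_pow3 m); clear; lia.
apply: (not_badly_approximable ha sQd HC) => K.
have Qt0 : Q t != 0 by case: (hPQ t).
have [B HB] := poly_large_neq0 Qt0.
have [n le_n hn] := hensel_orbit p_pr p_odd p3 Eb pw Eo pu dQ1 K (maxn K B) Qb2.
have p1 := prime_gt1 p_pr.
move: le_n; rewrite geq_max => /andP[leK leB].
exists (p ^ K)%N, (n0 + n)%N; split.
- exact: ltnW (ltn_expl _ p1).
- apply: HB; rewrite (leq_trans leB) // (leq_trans (leq_addl n0 n)) //.
  rewrite (leq_trans (ltnW (ltn_expl _ (isT : 1 < 3)%N))) //.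
  by rewrite ltnW // ltn_expl // (leq_trans _ ha).
- by rewrite expnD expnM.
apply: dvdz_trans (dvdz_f3_num n pb a0).
by rewrite dvdzE !absz_nat dvdn_exp2l.
Qed.
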